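(* Consider the following five properties of a compact set $E\subset\mathbb{C}$: (a) $\dim_H E=0$; (b) $\operatorname{Cap} E=0$; (c) $E$ is HNUP; (d) $m_2(E)=0$; (e) $E$ is porous. Among the twenty implications ''$X\Rightarrow Y$ for every compact $E\subset\mathbb{C}$'', with $X\neq Y$ ranging over these properties, the following hold and fail exactly as indicated. The following seven implications hold for every compact set $E\subset\mathbb{C}$: 1. $\operatorname{Cap}E=0$ implies $\dim_H E=0$; 2. $\dim_H E=0$ implies $E$ is HNUP; 3. $\operatorname{Cap}E=0$ implies $E$ is HNUP; 4. $\dim_H E=0$ implies $m_2(E)=0$; 5. $\operatorname{Cap}E=0$ implies $m_2(E)=0$; 6. $E$ porous implies $m_2(E)=0$; together with the trivial implications $X\Rightarrow X$ (so the non-trivial valid implications are precisely the six listed), and each of the following fourteen implications fails, i.e. for each one there is a compact set $E\subset\mathbb{C}$ satisfying the first property but not the second: 1. $E$ HNUP $\Rightarrow$ $\dim_H E=0$; 2. $m_2(E)=0$ $\Rightarrow$ $\dim_H E=0$; 3. $E$ porous $\Rightarrow$ $\dim_H E=0$; 4. $\dim_H E=0$ $\Rightarrow$ $\operatorname{Cap}E=0$; 5. $E$ HNUP $\Rightarrow$ $\operatorname{Cap}E=0$; 6. $m_2(E)=0$ $\Rightarrow$ $\operatorname{Cap}E=0$; 7. $E$ porous $\Rightarrow$ $\operatorname{Cap}E=0$; 8. $m_2(E)=0$ $\Rightarrow$ $E$ HNUP; 9. $E$ porous $\Rightarrow$ $E$ HNUP; 10. $E$ HNUP $\Rightarrow$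 $m_2(E)=0$; 11. $\dim_H E=0$ $\Rightarrow$ $E$ porous; 12. $\operatorname{Cap}E=0$ $\Rightarrow$ $E$ porous; 13. $E$ HNUP $\Rightarrow$ $E$ porous; 14. $m_2(E)=0$ $\Rightarrow$ $E$ porous.
   Context: $m_2$ is Lebesgue 2-dimensional measure on $\mathbb{C}\cong\mathbb{R}^2$, and $\dim_H$ is Hausdorff dimension with respect to the Euclidean metric. Logarithmic capacity: for a compact set $E\subset\mathbb{C}$ and $n\ge 2$, let $P_n=\max\prod_{1\le j<k\le n}|z_j-z_k|$ over $z_1,\dots,z_n\in E$, and $D_n=P_n^{2/(n(n-1))}$. The sequence $D_n$ is non-increasing, and $\operatorname{Cap}E=\lim_{n\to\infty}D_n$. Uniformly perfect: for $w\in\mathbb{C}$ and $0<r<R<\infty$ let $\mathrm{Ann}(w;r,R)=\{z\in\mathbb{C}: r<|z-w|<R\}$, with modulus $\log(R/r)$. The annulus $A$ separates a set $F\subset\mathbb{C}$ if $F\cap A=\emptyset$ and $F$ intersects both components of $\mathbb{C}\setminus A$. A compact set $F\subset\mathbb{C}$ with two or more points is uniformly perfect if there is a uniform finite upper bound on the moduli of all annuli which separate $F$. HNUP (hereditarily non uniformly perfect): a compact set $E$ is HNUP if no (compact) subset of $E$ is uniformly perfect. Porous: with $B(a,r)=\{z:|z-a|<r\}$, a compact set $E\subset\mathbb{C}$ is porous if there exists a constant $c>0$ such that for every $a\in E$ and every $r>0$ there exists a ball $B(b,cr)\subset B(a,r)$ with $B(b,cr)\cap E=\emptyset$. *)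

(* Defs.v *)
From HB Require Import structures.
From mathcomp Require Import all_boot all_order all_algebra.
From mathcomp Require Import all_classical all_reals all_analysis.

Set Implicit Arguments.
Unset Strict Implicit.
Unset Printing Implicit Defensive.

Import Order.TTheory GRing.Theory Num.Theory.
Import numFieldNormedType.Exports.

Local Open Scope classical_set_scope.
Local Open Scope ring_scope.

(* The complex plane as R^2: [compact], [connected_component], ... refer to the
   product topology, which is the Euclidean one. The library's norm on the
   product is the max norm, hence the explicit Euclidean distance below. *)
Notation plane R := (R * R)%type.

Section Plane.
Variable R : realType.
Implicit Types (E F U : set (plane R)) (a w x y z : plane R).

Definition edist x y : R :=
  Num.sqrt ((x.1 - y.1) ^+ 2 + (x.2 - y.2) ^+ 2).

Definition disc a (r : R) : set (plane R) := [set z | edist z a < r].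

(* The product of the (uncompleted) Borel-Lebesgue measures; it is meaningful
   on Borel sets, in particular on compact sets. *)
Definition m2 : set (plane R) -> \bar R :=
  (@lebesgue_measure R \x @lebesgue_measure R)%E.

(* Equal to -oo on the empty set. *)
Definition diam U : \bar R :=
  ereal_sup [set (edist p.1 p.2)%:E | p in U `*` U].

(* diam(U)^s, where the empty set contributes 0 (also for s = 0) and
   a nonempty U contributes 1 for s = 0. *)
Definition diam_pow (s : R) U : \bar R :=
  if `[< U = set0 >] then 0%E else poweR (diam U) s.

Definition hausdorff_pre (s d : R) E : \bar R :=
  ereal_inf [set (\sum_(0 <= i <oo) diam_pow s (V i))%E | V in
    [set V : nat -> set (plane R) |
      (forall i, (diam (V i) <= d%:E)%E) /\ E `<=` \bigcup_i V i]].

Definition hausdorff_measure (s : R) E : \bar R :=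
  ereal_sup [set hausdorff_pre s d E | d in [set d : R | 0 < d]].

Definition dimH E : \bar R :=
  ereal_inf [set s%:E | s in
    [set s : R | 0 <= s /\ hausdorff_measure s E = 0%E]].

(* For E compact and nonempty the supremum is a maximum. For E empty and
   n > 0 it is sup set0 = 0, so that the empty set has capacity 0. *)
Definition max_prod E (n : nat) : R :=
  sup [set \prod_(p : 'I_n * 'I_n | (p.1 < p.2)%N) edist (z p.1) (z p.2)
      | z in [set z : 'I_n -> plane R | forall i, E (z i)]].

(* Only the values at n >= 2 are meaningful. *)
Definition n_diam E (n : nat) : R :=
  max_prod E n `^ (2 / (n%:R * (n%:R - 1))).

Definition Cap E : R := lim (n_diam E n @[n --> \oo]).

Definition Ann w (r s : R) : set (plane R) :=
  [set z | r < edist z w < s].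

(* For 0 < r < s the complement of the annulus has exactly two components. *)
Definition separates w (r s : R) F : Prop :=
  F `&` Ann w r s = set0 /\
  forall z, (~` Ann w r s) z ->
    F `&` connected_component (~` Ann w r s) z !=set0.

Definition uniformly_perfect F : Prop :=
  [/\ compact F,
      exists x y, [/\ F x, F y & x <> y] &
      exists M : R, forall w (r s : R), 0 < r -> r < s ->
        separates w r s F -> ln (s / r) <= M].

Definition HNUP E : Prop :=
  compact E /\ forall F, F `<=` E -> compact F -> ~ uniformly_perfect F.

Definition porous E : Prop :=
  compact E /\
  exists2 c : R, 0 < c &
    forall a (r : R), E a -> 0 < r ->
      exists2 b, disc b (c * r) `<=` disc a r & disc b (c * r) `&` E = set0.

End Plane.

(* Main.v *)
Require Import Defs.
From mathcomp Require Import all_boot all_order all_algebra.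
From mathcomp Require Import all_classical all_reals all_analysis.
From mathcomp Require Import ring lra zify.
Import Order.TTheory GRing.Theory Num.Theory.
Import numFieldNormedType.Exports.

Set Implicit Arguments.
Unset Strict Implicit.
Unset Printing Implicit Defensive.

Local Open Scope classical_set_scope.
Local Open Scope ring_scope.

(** If Cap E = 0, Leja's greedy choice of points yields monic polynomials of
    degree n bounded by h^n on E with h arbitrarily small, and Cartan's lemma
    covers the set where such a polynomial is small by discs of small total s-th
    power radius; hence dim E = 0.  In a uniformly perfect set every ball contains
    two separated balls of comparable size around points of the set, which bounds
    the total s-th power radius of its covers from below for some s > 0; hence
    dim E = 0 implies HNUP.  A porous set misses a definite proportion of every
    square, at a bounded finer scale.

    Counterexamples: a segment (porous, not HNUP); a nest of squares in which, at
    infinitely many scales, every point has been trapped in an almost isolated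
    central subsquare, at an arbitrarily small cost in area (HNUP, positive
    measure); a Cantor set with 4^k intervals of length about 16^(-2^k) at step k
    (dimension 0, positive capacity); grids of mesh 1/k^2 and width 1/k
    shrinking to the origin (capacity 0, not porous). *)

(* The library has another [edist], which would shadow the Euclidean one. *)
Local Notation edist := Defs.edist.

(** * Euclidean distance *)

(** Finite lists of discs with small total s-th power radius are the common currency: on a compact
    set [dimH E = 0] amounts to having them for every s > 0, and every argument about dimension only
    produces or consumes such lists. The transfinite diameter leads to small polynomials directly,
    so no energies or equilibrium measures are involved. HNUP quantifies over all compact subsets,
    which may avoid any prescribed place. The set of positive measure must therefore offer a thick
    empty annulus near whatever part of it a subset occupies, which is why its construction is
    recursive. In the Cantor set log(1/length) grows like 2^k against 4^k intervals: k/2^k tends to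
    0, which kills the dimension, while the sum of 2^k/4^k converges, which keeps the capacity
    positive. For the grids, mesh over width tends to 0, which defeats every porosity constant,
    while the transfinite diameter does not see finite sets. Four examples settle all fourteen
    failures, since the valid implications supply their remaining properties. *)

Section EuclideanDistance.
Variable R : realType.
Implicit Types (w x y z : plane R) (r s : R).

Lemma edist_ge0 x y : 0 <= edist x y.
Proof. exact: sqrtr_ge0. Qed.

Lemma edistC x y : edist x y = edist y x.
Proof. by rewrite /edist; congr Num.sqrt; ring. Qed.

Lemma edistxx x : edist x x = 0.
Proof. by rewrite /edist !subrr expr0n addr0 sqrtr0. Qed.

Lemma edist_sqr x y : edist x y ^+ 2 = (x.1 - y.1) ^+ 2 + (x.2 - y.2) ^+ 2.
Proof. by rewrite sqr_sqrtr // addr_ge0 // sqr_ge0. Qed.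

Lemma edist_le_sqr x y r : 0 <= r ->
  (edist x y <= r) = ((x.1 - y.1) ^+ 2 + (x.2 - y.2) ^+ 2 <= r ^+ 2).
Proof. by move=> r0; rewrite -edist_sqr ler_pXn2r ?nnegrE ?edist_ge0. Qed.

Lemma edist_eq0 x y : edist x y = 0 -> x = y.
Proof.
move=> d0; have := edist_sqr x y; rewrite d0 expr0n /=.
move/esym/eqP; rewrite paddr_eq0 ?sqr_ge0 // !sqrf_eq0 !subr_eq0.
by case: x y {d0} => [a b] [c d] /= /andP[/eqP-> /eqP->].
Qed.

Lemma edist_gt0 x y : x <> y -> 0 < edist x y.
Proof.
by move=> xy; rewrite lt_def edist_ge0 andbT; apply/eqP => /edist_eq0.
Qed.

Lemma edist_triangle y x z : edist x z <= edist x y + edist y z.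
Proof.
rewrite edist_le_sqr ?addr_ge0 ?edist_ge0 //.
have := edist_sqr x y; have := edist_sqr y z.
move: (edist_ge0 x y) (edist_ge0 y z); move: (edist x y) (edist y z) => d e.
move=> d0 e0 ee dd.
set a := x.1 - y.1 in dd *; set b := x.2 - y.2 in dd *.
set u := y.1 - z.1 in ee *; set v := y.2 - z.2 in ee *.
have -> : x.1 - z.1 = a + u by rewrite /a /u; ring.
have -> : x.2 - z.2 = b + v by rewrite /b /v; ring.
(* Cauchy-Schwarz, from Lagrange's identity *)
suff: a * u + b * v <= d * e by nra.
apply: le_trans (ler_norm _) _.
rewrite -(ler_pXn2r (n := 2)) ?nnegrE ?mulr_ge0 // real_normK ?num_real //.
rewrite exprMn dd ee; have := sqr_ge0 (a * v - b * u); nra.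
Qed.

Lemma le_edist1 x y : `|x.1 - y.1| <= edist x y.
Proof.
rewrite -(ler_pXn2r (n := 2)) ?nnegrE ?edist_ge0 // edist_sqr.
by rewrite real_normK ?num_real // lerDl sqr_ge0.
Qed.

Lemma le_edist2 x y : `|x.2 - y.2| <= edist x y.
Proof.
rewrite -(ler_pXn2r (n := 2)) ?nnegrE ?edist_ge0 // edist_sqr.
by rewrite real_normK ?num_real // lerDr sqr_ge0.
Qed.

Lemma edist_le_add x y : edist x y <= `|x.1 - y.1| + `|x.2 - y.2|.
Proof.
rewrite edist_le_sqr ?addr_ge0 //.
rewrite -(real_normK (num_real (x.1 - y.1))) -(real_normK (num_real (x.2 - y.2))).
have := normr_ge0 (x.1 - y.1); have := normr_ge0 (x.2 - y.2); nra.
Qed.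

Lemma edist_continuous w : continuous (fun z => edist z w).
Proof.
move=> z; apply: continuous_comp; last exact: sqrt_continuous.
apply: cvgD; rewrite expr2; under eq_fun do rewrite expr2; apply: cvgM;
  by apply: cvgB; [exact: cvg_fst || exact: cvg_snd|exact: cvg_cst].
Qed.

Lemma open_disc w r : open (disc w r).
Proof.
have -> : disc w r = (fun z => edist z w) @^-1` [set t | t < r] by [].
by apply: open_comp; [move=> z _; exact: edist_continuous|exact: open_lt].
Qed.

Lemma plane_hausdorff : hausdorff_space (plane R).
Proof. exact: norm_hausdorff. Qed.

Lemma compact_edist_bounded (E : set (plane R)) : compact E ->
  exists2 D : R, 1 <= D & forall x y, E x -> E y -> edist x y <= D.
Proof.
move=> /compact_bounded[M [Mr ME]].
have M1 : M < `|M| + 1 by rewrite (le_lt_trans (ler_norm M)) // ltrDl.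
have {}ME x : E x -> `|x.1| <= `|M| + 1 /\ `|x.2| <= `|M| + 1.
  move=> Ex; have : `|x| <= `|M| + 1 := ME _ M1 x Ex.
  by rewrite prod_normE ge_max => /andP[].
exists (4 * (`|M| + 1)); first by have := normr_ge0 M; lra.
move=> x y /ME[x1 x2] /ME[y1 y2]; apply: le_trans (edist_le_add x y) _.
by move: x1 x2 y1 y2 (ler_normB x.1 y.1) (ler_normB x.2 y.2); lra.
Qed.

End EuclideanDistance.

(** * Separating annuli *)

Section Separation.
Variable R : realType.
Implicit Types (A F : set (plane R)) (w x y z : plane R) (r s : R).

Definition affine x y (t : R) : plane R :=
  (x.1 + t * (y.1 - x.1), x.2 + t * (y.2 - x.2)).

Lemma affine_continuous x y : continuous (affine x y).
Proof.
move=> t; apply: (@cvg_pair _ _ _ _ (nbhs _) (nbhs _)); apply: cvgD; try exact: cvg_cst;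
  by apply: cvgM; [exact: cvg_id|exact: cvg_cst].
Qed.

Lemma connected_affine x y : connected (affine x y @` `[0, 1]).
Proof.
apply: connected_continuous_connected; first exact: segment_connected.
exact: continuous_subspaceT (@affine_continuous x y).
Qed.

Lemma segment_component A x y :
  (forall t, 0 <= t <= 1 -> A (affine x y t)) -> connected_component A x y.
Proof.
move=> Axy; apply: (@connected_component_max _ A (affine x y @` `[0, 1]) x).
- exists 0; first by rewrite /= in_itv /= lexx ler01.
  by rewrite /affine !mul0r !addr0 -surjective_pairing.
- by move=> _ [t /= tI <-]; apply: Axy; rewrite in_itv /= in tI.
- exact: connected_affine.
- exists 1; first by rewrite /= in_itv /= lexx ler01.
  by rewrite /affine !mul1r !(addrC _ (_ - _)) !subrK -surjective_pairing.
Qed.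

(** The closed disc is star-shaped about [w], so two of its points are joined through the centre. *)
Lemma cdisc_component A w r z y : (forall x, edist x w <= r -> A x) ->
  edist z w <= r -> edist y w <= r -> connected_component A z y.
Proof.
move=> rA; suff rC x : edist x w <= r -> connected_component A w x.
  by move=> /rC zC /rC; exact/connected_component_trans/connected_component_sym.
move=> xr; apply: segment_component => t /andP[t0 t1]; apply: rA.
apply: le_trans xr; rewrite edist_le_sqr ?edist_ge0 // edist_sqr /=.
set a := x.1 - w.1; set b := x.2 - w.2.
have t2 : t ^+ 2 <= 1 by rewrite expr_le1.
have -> : (w.1 + t * a - w.1) ^+ 2 + (w.2 + t * b - w.2) ^+ 2 =
          t ^+ 2 * (a ^+ 2 + b ^+ 2) by ring.
by apply: ler_piMl => //; rewrite addr_ge0 ?sqr_ge0.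
Qed.

(** The inner product of the vectors from [w] to [x] and from [w] to [y]. *)
Definition pdot w x y : R := (x.1 - w.1) * (y.1 - w.1) + (x.2 - w.2) * (y.2 - w.2).

Lemma pdot_le w x y : pdot w x y <= edist x w * edist y w.
Proof.
apply: le_trans (ler_norm _) _.
rewrite -(ler_pXn2r (n := 2)) ?nnegrE ?mulr_ge0 ?edist_ge0 //.
rewrite real_normK ?num_real // exprMn !edist_sqr /pdot.
set a := x.1 - w.1; set b := x.2 - w.2; set u := y.1 - w.1; set v := y.2 - w.2.
have := sqr_ge0 (a * v - b * u); nra.
Qed.

(* The segment stays in a half-plane at distance at least [s] from [w]. *)
Lemma halfplane_component A w s u x y : (forall z, s <= edist z w -> A z) ->
  0 < edist u w -> s * edist u w <= pdot w x u -> s * edist u w <= pdot w y u ->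
  connected_component A x y.
Proof.
move=> sA u0 sx sy; apply: segment_component => t /andP[t0 t1]; apply: sA.
rewrite -(ler_pM2r u0); apply: le_trans (pdot_le _ _ _).
have -> : pdot w (affine x y t) u = (1 - t) * pdot w x u + t * pdot w y u.
  by rewrite /pdot /=; ring.
have -> : s * edist u w = (1 - t) * (s * edist u w) + t * (s * edist u w) by ring.
by apply: lerD; apply: ler_wpM2l => //; rewrite subr_ge0.
Qed.

(** The segment from [z] to [y] may cross the disc, so a detour is made. With [w] as origin, the
    path z, z + p, y + p, y stays in half-planes with normals z, p, y in turn, each at distance at
    least [s] from the origin; this works because p is orthogonal to z and has nonnegative inner
    product with y. *)
Lemma exterior_component A w s z y : 0 < s ->
  (forall x, s <= edist x w -> A x) ->
  s <= edist z w -> s <= edist y w -> connected_component A z y.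
Proof.
move=> s0 sA sz sy.
have z0 := lt_le_trans s0 sz; have y0 := lt_le_trans s0 sy.
have [e e1 e0] : exists2 e : R, e ^+ 2 = 1 &
  0 <= e * ((z.1 - w.1) * (y.2 - w.2) - (z.2 - w.2) * (y.1 - w.1)).
  set c := _ - _; have [c0|c0] := leP 0 c.
    by exists 1; rewrite ?expr1n ?mul1r.
  by exists (-1); rewrite ?sqrrN ?expr1n // mulN1r oppr_ge0 ltW.
(* [p - w] is [z - w] turned by a right angle towards [y - w] *)
pose p : plane R := (w.1 - e * (z.2 - w.2), w.2 + e * (z.1 - w.1)).
have pz : edist p w = edist z w.
  rewrite /edist; congr Num.sqrt; rewrite /=.
  have -> : (w.1 - e * (z.2 - w.2) - w.1) ^+ 2 + (w.2 + e * (z.1 - w.1) - w.2) ^+ 2 =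
    e ^+ 2 * ((z.1 - w.1) ^+ 2 + (z.2 - w.2) ^+ 2) by ring.
  by rewrite e1 mul1r.
have self u : pdot w u u = edist u w * edist u w.
  by rewrite -expr2 edist_sqr /pdot; ring.
have pz0 : pdot w p z = 0 by rewrite /pdot /=; ring.
have py0 : 0 <= pdot w p y.
  by rewrite /pdot /=; apply: le_trans e0 _; rewrite le_eqVlt; apply/orP; left; apply/eqP; ring.
have sq u : s <= edist u w -> s * edist u w <= pdot w u u.
  by move=> su; rewrite self ler_wpM2r // edist_ge0.
pose add (u v : plane R) : plane R := (u.1 + v.1 - w.1, u.2 + v.2 - w.2).
have addE u v q : pdot w (add u v) q = pdot w u q + pdot w v q.
  by rewrite /pdot /=; ring.
have pC u v : pdot w u v = pdot w v u by rewrite /pdot; ring.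
apply: (@connected_component_trans _ _ (add p z)); last first.
  apply: (@connected_component_trans _ _ (add p y)); last first.
    apply: (halfplane_component sA y0); last exact: sq.
    by rewrite addE ler_wpDl // sq.
  apply: (halfplane_component (u := p) sA); rewrite ?pz // addE -?pz.
    by rewrite (pC z) pz0 addr0 sq // pz.
  by rewrite (pC y) ler_wpDr // sq // pz.
apply: (halfplane_component sA z0); first exact: sq.
by rewrite addE pz0 add0r sq.
Qed.

(** The complement of the annulus consists of a closed disc and an exterior, both connected, so one
    point of [F] in each meets the component of every point. *)
Lemma separates_disc_exterior w r s F : 0 < r -> r < s ->
  F `&` Ann w r s = set0 -> (exists2 x, F x & edist x w <= r) ->
  (exists2 y, F y & s <= edist y w) -> separates w r s F.
Proof.
move=> r0 rs FA [x Fx xr] [y Fy ys]; split=> // z /= /negP.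
rewrite negb_and -!leNgt => /orP[zr|sz].
  exists x; split=> //; apply: cdisc_component zr xr => v vr.
  by apply/negP; rewrite negb_and -!leNgt vr.
exists y; split=> //; apply: exterior_component sz ys; first exact: lt_trans rs.
by move=> v sv; apply/negP; rewrite negb_and -!leNgt sv orbT.
Qed.

(** A connected [F] missing the annulus lies in one component of the complement. If it met the
    components of both [w] and a point at distance [s], these would coincide, and the distance to
    [w] would take the value (r + s)/2 there, inside the annulus. *)
Lemma connected_not_separates w r s F : 0 < r -> r < s -> connected F ->
  ~ separates w r s F.
Proof.
move=> r0 rs cF [FA Fz].
pose z : plane R := (w.1 + s, w.2).
have Aw : (~` Ann w r s) w by rewrite /Ann /= edistxx ltNge ltW.
have zs : edist z w = s.
  rewrite /edist /z /= subrr expr0n addr0 addrC addKr sqrtr_sqr.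
  by rewrite ger0_norm // (le_trans (ltW r0) (ltW rs)).
have Az : (~` Ann w r s) z by rewrite /Ann /= zs ltxx andbF.
have FnA : F `<=` ~` Ann w r s.
  by move=> x Fx Ax; have : (F `&` Ann w r s) x by []; rewrite FA.
have comp v : (~` Ann w r s) v -> F `<=` connected_component (~` Ann w r s) v.
  move=> /Fz[x [Fx vx]] y Fy; apply: connected_component_trans vx _.
  exact: connected_component_max cF _ Fy.
have [x [Fx _]] := Fz w Aw.
have wz : connected_component (~` Ann w r s) w z.
  exact: connected_component_trans (comp _ Aw _ Fx)
    (connected_component_sym (comp _ Az _ Fx)).
have cC := @component_connected _ (~` Ann w r s) w.
have : connected ((fun v => edist v w) @` connected_component (~` Ann w r s) w).
  apply: connected_continuous_connected => //.
  exact/continuous_subspaceT/edist_continuous.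
move=> /connected_intervalP/(_ 0 s).
have w0 : ((fun v => edist v w) @` connected_component (~` Ann w r s) w) 0.
  by exists w; [exact: connected_component_refl|exact: edistxx].
have zC : ((fun v => edist v w) @` connected_component (~` Ann w r s) w) s.
  by exists z.
move=> /(_ w0 zC ((r + s) / 2)) [].
  by apply/andP; split; lra.
move=> v /connected_component_sub Av vE; apply: Av; rewrite /Ann /= vE.
by apply/andP; split; lra.
Qed.

End Separation.

(** * Covers of sets of dimension zero *)

Section DimensionZero.
Variable R : realType.
Implicit Types (E F U : set (plane R)) (w x y z : plane R) (r s e : R).
Implicit Types (L : seq (plane R * R)).

(** Pairs of centre and radius, in a list rather than a sequence: compactness makes finite covers
    sufficient, and the lower bound for perfect sets is an induction on the length. *)
Definition disc_cover L E :=
  (forall p, p \in L -> 0 < p.2) /\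
  forall x, E x -> exists2 p, p \in L & disc p.1 p.2 x.

Lemma sub_disc_cover L E F : F `<=` E -> disc_cover L E -> disc_cover L F.
Proof. by move=> FE [L0 EL]; split=> // x /FE/EL. Qed.

Definition dim_sum s L : R := \sum_(p <- L) p.2 `^ s.

Lemma dim_sum_ge s L p : p \in L -> p.2 `^ s <= dim_sum s L.
Proof.
move=> pL; rewrite /dim_sum (big_rem p) //= lerDl.
by apply: sumr_ge0 => q _; exact: powR_ge0.
Qed.

Lemma diam_le U r : (forall x y, U x -> U y -> edist x y <= r) ->
  (diam U <= r%:E)%E.
Proof.
by move=> Ur; apply: ge_ereal_sup => _ [[x y] /= [Ux Uy]] <-; rewrite lee_fin Ur.
Qed.

Lemma edist_diam U x y : U x -> U y -> ((edist x y)%:E <= diam U)%E.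
Proof. by move=> Ux Uy; apply: ereal_sup_ubound; exists (x, y). Qed.

Lemma diam_ge0 U x : U x -> (0 <= diam U)%E.
Proof. by move=> Ux; apply: le_trans (edist_diam Ux Ux); rewrite edistxx. Qed.

Lemma diam_pow_ge0 s U : (0 <= diam_pow s U)%E.
Proof. by rewrite /diam_pow; case: asboolP => // _; exact: poweR_ge0. Qed.

Lemma diam_pow_le s U r : 0 <= s -> 0 <= r ->
  (forall x y, U x -> U y -> edist x y <= r) -> (diam_pow s U <= (r `^ s)%:E)%E.
Proof.
move=> s0 r0 Ur; rewrite /diam_pow; case: asboolP => [_|/eqP/set0P[x Ux]].
  by rewrite lee_fin powR_ge0.
rewrite -poweR_EFin; apply: gt0_ler_poweR => //; last exact: diam_le.
  by rewrite in_itv /= (diam_ge0 Ux) leey.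
by rewrite in_itv /= lee_fin r0 leey.
Qed.

Lemma hausdorff_pre_ge0 s d E : (0 <= hausdorff_pre s d E)%E.
Proof.
apply: le_ereal_inf_tmp => _ [V _ <-].
by apply: nneseries_ge0 => n _ _; exact: diam_pow_ge0.
Qed.

Lemma hausdorff_measure_ge0 s E : (0 <= hausdorff_measure s E)%E.
Proof.
apply: le_ereal_sup_tmp; exists (hausdorff_pre s 1 E).
  by exists 1 => //=; rewrite ltr01.
exact: hausdorff_pre_ge0.
Qed.

Lemma dimH_ge0 E : (0 <= dimH E)%E.
Proof. by apply: le_ereal_inf_tmp => _ [s [s0 _] <-]; rewrite lee_fin. Qed.

Lemma sum_nth_le (T : Type) (x0 : T) (l : seq T) (g : T -> R) n :
  (forall t, 0 <= g t) ->
  \sum_(0 <= i < n) (if (i < size l)%N then g (nth x0 l i) else 0) <=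
  \sum_(t <- l) g t.
Proof.
move=> g0; elim: l n => [|t l IH] n; first by rewrite big1 // big_nil.
rewrite big_cons; case: n => [|n].
  by rewrite big_geq // addr_ge0 // sumr_ge0.
by rewrite big_nat_recl //= lerD2l; exact: IH.
Qed.

(** The bound on the sum forces every single radius below d/2, so the discs are admissible at scale
    [d]. The factor 2^s passes from radii to diameters. *)
Lemma hausdorff_pre_le s d E L : 0 < s -> 0 < d -> disc_cover L E ->
  dim_sum s L <= (d / 2) `^ s ->
  (hausdorff_pre s d E <= (2 `^ s * dim_sum s L)%:E)%E.
Proof.
move=> s0 d0 [L0 EL] Ld.
have r_le p : p \in L -> 2 * p.2 <= d.
  move=> pL; have := le_trans (dim_sum_ge s pL) Ld.
  rewrite leNgt; apply: contraNle => pd; apply: gt0_ltr_powR => //.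
  - by rewrite nnegrE; lra.
  - by rewrite nnegrE ltW // L0.
  - lra.
pose p0 : plane R * R := ((0, 0), 0).
pose V i : set (plane R) :=
  if (i < size L)%N then disc (nth p0 L i).1 (nth p0 L i).2 else set0.
have Vdiam i x y : V i x -> V i y -> edist x y <= 2 * (nth p0 L i).2.
  rewrite /V; case: ifP => // _; rewrite /disc /= => xp yp.
  apply: le_trans (edist_triangle (nth p0 L i).1 _ _) _.
  by rewrite (edistC _ y); lra.
apply: ge_ereal_inf; exists (\sum_(0 <= i <oo) diam_pow s (V i))%E.
  exists V => //; split.
    move=> i; apply: diam_le => x y Vx Vy.
    apply: le_trans (Vdiam i x y Vx Vy) _; apply: r_le.
    by move: Vx; rewrite /V; case: ifP => // iL _; exact: mem_nth.
  move=> x /EL[p pL px]; exists (index p L) => //.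
  by rewrite /V index_mem pL nth_index.
apply: lime_le; first by apply: is_cvg_nneseries => n _ _; exact: diam_pow_ge0.
apply: nearW => n; rewrite /dim_sum big_distrr /=.
under [X in (_ <= X%:E)%E]eq_bigr => p _ do rewrite -[2 `^ s * _]ger0_norm ?mulr_ge0 ?powR_ge0 //.
apply: (@le_trans _ _ (\sum_(0 <= i < n) (if (i < size L)%N then
  `|2 `^ s * (nth p0 L i).2 `^ s| else 0)%:E)%E).
  apply: lee_sum => i _; rewrite /V; case: ifP => iL.
    have r0 : 0 <= (nth p0 L i).2 by apply/ltW/L0/mem_nth.
    rewrite ger0_norm ?mulr_ge0 ?powR_ge0 // -powRM //.
    apply: diam_pow_le; [exact: ltW|by rewrite mulr_ge0|move=> x y xV yV].
    by apply: Vdiam; rewrite /V iL.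
  by rewrite /diam_pow; case: asboolP => // /(_ erefl).
by rewrite sumEFin lee_fin sum_nth_le.
Qed.

Lemma dimH_eq0_of_covers E :
  (forall s e, 0 < s -> 0 < e -> exists2 L, disc_cover L E & dim_sum s L <= e) ->
  dimH E = 0%E.
Proof.
move=> EL; apply/eqP; rewrite eq_le dimH_ge0 andbT.
apply/lee_addgt0Pr => s s0; rewrite add0e.
apply: ge_ereal_inf; exists s%:E => //; exists s => //; split; first exact: ltW.
apply/eqP; rewrite eq_le hausdorff_measure_ge0 andbT.
apply: ge_ereal_sup => _ [d /= d0 <-]; apply/lee_addgt0Pr => e e0; rewrite add0e.
have s2 : 0 < 2 `^ s :> R by rewrite powR_gt0.
have [|L LE Ls] := EL s (Order.min ((d / 2) `^ s) (e / 2 `^ s)) s0.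
  by rewrite lt_min powR_gt0 ?divr_gt0.
move: Ls; rewrite le_min => /andP[Ld Le].
apply: le_trans (hausdorff_pre_le s0 d0 LE Ld) _.
by rewrite lee_fin mulrC -ler_pdivlMr.
Qed.

Lemma compact_nat_cover E (c : nat -> plane R) (r : nat -> R) : compact E ->
  (forall x, E x -> exists n, disc (c n) (r n) x) ->
  exists N, forall x, E x -> exists2 n, (n < N)%N & disc (c n) (r n) x.
Proof.
move=> /compact_near_coveringP cE Ec.
have [|N _ NE] := cE _ \oo (fun N x => exists2 n, (n < N)%N & disc (c n) (r n) x) _.
  move=> x /Ec[n xn]; exists (disc (c n) (r n), [set N | (n < N)%N]) => /=.
    split; last by exists n.+1.
    by apply: open_nbhs_nbhs; split; [exact: open_disc|].
  by move=> [y N] /= [yn nN]; exists n.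
by exists N => x Ex; exact: (NE N (leqnn N) x Ex).
Qed.

Lemma sum_half_powers n (e : R) : 0 <= e ->
  \sum_(0 <= i < n) e / 2 ^+ i.+1 <= e.
Proof.
move=> e0; suff -> : \sum_(0 <= i < n) e / 2 ^+ i.+1 = e - e / 2 ^+ n.
  by rewrite gerBl divr_ge0 // exprn_ge0.
elim: n => [|n IH]; first by rewrite big_geq // expr0 divr1 subrr.
rewrite big_nat_recr //= IH exprS.
by field; rewrite expf_neq0 //= pnatr_eq0.
Qed.

Lemma covers_of_dimH_eq0 E s e : compact E -> dimH E = 0%E ->
  0 < s -> 0 < e -> exists2 L, disc_cover L E & dim_sum s L <= e.
Proof.
move=> cE dE s0 e0.
have e20 : 0 < e / 2 by rewrite divr_gt0.
have : (dimH E < s%:E)%E by rewrite dE lte_fin.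
move=> /ereal_inf_lt[_ [t [t0 Ht] <-]]; rewrite lte_fin => ts.
(* Scale 1 is enough: for diameters at most 1, raising the exponent from [t] to [s] only decreases
   the powers. *)
have : (hausdorff_pre t 1 E < (e / 2)%:E)%E.
  apply: (@le_lt_trans _ _ 0%E); last by rewrite lte_fin.
  by rewrite -Ht; apply: ereal_sup_ubound; exists 1 => //=; rewrite ltr01.
move=> /ereal_inf_lt[_ [V [V1 EV] <-] Vs].
pose delta i := if `[< V i = set0 >] then 0 else fine (diam (V i)).
have delta_fin i x : V i x -> diam (V i) = (delta i)%:E.
  move=> Vx; rewrite /delta; case: asboolP => [V0|_]; first by rewrite V0 in Vx.
  rewrite fineK // ge0_fin_numE ?(diam_ge0 Vx) //.
  by apply: le_lt_trans (V1 i) _; rewrite ltry.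
have delta_ge0 i : 0 <= delta i.
  rewrite /delta; case: asboolP => // /eqP/set0P[x Vx].
  by rewrite fine_ge0 // (diam_ge0 Vx).
have delta_pow i : ((delta i `^ s)%:E <= diam_pow t (V i))%E.
  rewrite /diam_pow; case: asboolP => [V0|/eqP/set0P[x Vx]].
    by rewrite /delta; case: asboolP => // _; rewrite powR0 // gt_eqF.
  rewrite (delta_fin _ _ Vx) poweR_EFin lee_fin.
  have [->|d0] := eqVneq (delta i) 0.
    by rewrite powR0 ?gt_eqF // powR_ge0.
  apply: ger_powR; last exact: ltW.
  by rewrite lt_def d0 delta_ge0 -lee_fin -(delta_fin _ _ Vx) V1.
(* A piece may have diameter 0, and open discs are needed for compactness. Each radius is therefore
   enlarged strictly, by an amount whose s-th power cost sums to at most e/2. *)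
pose rho i := (delta i `^ s + (e / 2) / 2 ^+ i.+1) `^ s^-1.
have sV : s * s^-1 = 1 by rewrite divff // gt_eqF.
have inc_gt0 i : 0 < (e / 2) / 2 ^+ i.+1 by rewrite divr_gt0 // exprn_gt0.
have rho_s i : rho i `^ s = delta i `^ s + (e / 2) / 2 ^+ i.+1.
  rewrite -powRrM mulVf ?gt_eqF // powRr1 // addr_ge0 ?powR_ge0 //; exact: ltW.
have rho_gt i : delta i < rho i.
  rewrite -[ltLHS](powRr1 (delta_ge0 i)) -sV powRrM.
  apply: gt0_ltr_powR; rewrite ?invr_gt0 ?nnegrE ?addr_ge0 ?powR_ge0 ?ltrDl //.
  exact: ltW.
pose c i := if pselect (V i !=set0) is left h then sval (cid h) else (0, 0).
have cV i x : V i x -> V i (c i).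
  move=> Vx; rewrite /c; case: pselect => [h|[]]; last by exists x.
  exact: (svalP (cid h)).
have [|N EN] := @compact_nat_cover E c rho cE.
  move=> x /EV[i _ Vx]; exists i; rewrite /disc /=.
  apply: le_lt_trans (rho_gt i); rewrite -lee_fin -(delta_fin _ _ Vx).
  by apply: edist_diam => //; exact: cV Vx.
exists [seq (c i, rho i) | i <- index_iota 0 N].
  split=> [_ /mapP[i _ ->] /=|x /EN[i iN xi]].
    by apply: le_lt_trans (rho_gt i).
  by exists (c i, rho i) => //; apply: map_f; rewrite mem_index_iota.
rewrite /dim_sum big_map /=.
under eq_bigr do rewrite rho_s.
rewrite big_split /= [leRHS](splitr e); apply: lerD; last exact/sum_half_powers/ltW.
rewrite -lee_fin -sumEFin; apply: le_trans (ltW Vs).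
apply: le_trans (@nneseries_lim_ge _ _ xpredT 0 N _); last by move=> *; exact: diam_pow_ge0.
by apply: lee_sum => i _.
Qed.

End DimensionZero.

(** * Uniformly perfect sets have positive dimension *)

Section UniformlyPerfect.
Variable R : realType.
Implicit Types (E F U : set (plane R)) (w x y z : plane R) (r s e : R).
Implicit Types (L : seq (plane R * R)).

(* Each ball around a point of [F] contains two disjoint balls around points of
   [F] whose radii are smaller by the factor [8 K]; a small disc meets at most
   one of them, so a cover by small discs splits into two covers. *)
Lemma perfect_cover_ge F (K r0 s : R) : 1 < K -> 0 < s -> (8 * K) `^ s = 2 ->
  (forall x r, F x -> 0 < r -> r <= r0 ->
     exists2 y, F y & r / K < edist y x < r) ->
  forall L x r, F x -> 0 < r -> r <= r0 ->
  (forall p, p \in L -> 0 < p.2) ->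
  (forall z, F z -> edist z x <= r -> exists2 p, p \in L & disc p.1 p.2 z) ->
  r `^ s / 2 <= dim_sum s L.
Proof.
move=> K1 s0 Ks FK L; have K0 : 0 < K by apply: lt_trans K1.
have [n] := ubnP (size L); elim: n L => // n IH L Ln x r Fx r_gt0 rr0 L0 Lx.
(* By the choice of [s], q^s is half of r^s. Hence one disc of radius at least q already suffices,
   and otherwise two subcovers contributing q^s/2 each do. *)
pose q := r / (8 * K).
have q0 : 0 < q by rewrite divr_gt0 // mulr_gt0.
have qs : q `^ s = r `^ s / 2.
  by rewrite /q powRM ?invr_ge0 ?mulr_ge0 ?ltW // -powR_inv1 ?mulr_ge0 ?ltW //
     -powRrM mulN1r powRN Ks.
have rE : r = 8 * (q * K) by rewrite /q; field; rewrite gt_eqF.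
have qK : q <= q * K by rewrite ler_peMr // ltW.
have [/hasP[p pL qp]|/hasPn Lq] := boolP (has (fun p => q <= p.2) L).
  rewrite -qs; apply: le_trans (dim_sum_ge s pL).
  by apply: ge0_ler_powR => //; rewrite ?nnegrE ltW // (lt_le_trans q0).
have {}Lq p : p \in L -> p.2 < q by move=> /Lq; rewrite -ltNge.
have [||y Fy /andP[ry yr]] := FK x (r / 2) Fx; [lra|lra|].
have {}ry : 4 * q < edist y x.
  by apply: le_lt_trans ry; rewrite rE le_eqVlt; apply/orP; left; apply/eqP;
     field; rewrite gt_eqF.
(* All radii are below q and [y] is more than 4q from [x]. A disc meeting the q-ball of [x] has its
   centre within 2q of [x]; one meeting the q-ball of [y] does not. Both sublists are nonempty,
   hence shorter than [L]. *)
pose a := fun p : plane R * R => edist p.1 x < 2 * q.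
pose L1 := [seq p <- L | a p]; pose L2 := [seq p <- L | ~~ a p].
have L12 : dim_sum s L = dim_sum s L1 + dim_sum s L2.
  by rewrite /dim_sum !big_filter (bigID a).
have sz : (size L1 + size L2 = size L)%N by rewrite !size_filter (count_predC a).
have cov1 z : F z -> edist z x <= q -> exists2 p, p \in L1 & disc p.1 p.2 z.
  move=> Fz zx; have [|p pL pz] := Lx z Fz; first lra.
  exists p => //; rewrite mem_filter pL andbT /a.
  have := edist_triangle z p.1 x; rewrite (edistC p.1 z).
  by move: pz (Lq p pL); rewrite /disc /=; lra.
have cov2 z : F z -> edist z y <= q -> exists2 p, p \in L2 & disc p.1 p.2 z.
  move=> Fz zy; have [|p pL pz] := Lx z Fz.
    by have := edist_triangle y z x; lra.
  exists p => //; rewrite mem_filter pL andbT /= /a -leNgt.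
  have := edist_triangle p.1 y x; have := edist_triangle z y p.1.
  rewrite (edistC y z); move: pz (Lq p pL); rewrite /disc /=; lra.
have [p1 p1L _] : exists2 p, p \in L1 & disc p.1 p.2 x.
  by apply: cov1; rewrite // edistxx ltW.
have [p2 p2L _] : exists2 p, p \in L2 & disc p.1 p.2 y.
  by apply: cov2; rewrite // edistxx ltW.
have sz1 : (0 < size L1)%N by case: (L1) p1L.
have sz2 : (0 < size L2)%N by case: (L2) p2L.
have qr0 : q <= r0 by lra.
rewrite L12 [leLHS]splitr -qs; apply: lerD.
  apply: (IH L1 _ x q) => //.
    by rewrite -ltnS (leq_trans _ Ln) // ltnS -sz -addn1 leq_add2l.
  by move=> p; rewrite mem_filter => /andP[_ /L0].
apply: (IH L2 _ y q) => //.
  by rewrite -ltnS (leq_trans _ Ln) // ltnS -sz addnC -addn1 leq_add2l.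
by move=> p; rewrite mem_filter => /andP[_ /L0].
Qed.

(** An annulus about [x] of modulus |M| + 1 exceeds the bound, so it cannot separate [F] and must
    contain one of its points. Its exterior does meet [F]: as r is at most half the distance of [x0]
    and [y0], one of them is at distance at least r from [x]. *)
Lemma uniformly_perfect_annulus F : uniformly_perfect F ->
  exists K r0 : R, [/\ 1 < K, 0 < r0 & forall x r, F x -> 0 < r -> r <= r0 ->
     exists2 y, F y & r / K < edist y x < r].
Proof.
move=> [_ [x0 [y0 [Fx0 Fy0 /edist_gt0 xy0]]] [M FM]].
pose K : R := expR (`|M| + 1).
have K1 : 1 < K by rewrite expR_gt1 ltr_wpDl.
have K0 : 0 < K by apply: lt_trans K1.
exists K, (edist x0 y0 / 2); split=> //; first by rewrite divr_gt0.
move=> x r Fx r_gt0 rr0; apply: contrapT => noy.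
have rK : r / K < r by rewrite ltr_pdivrMr // ltr_pMr.
have rK0 : 0 < r / K by rewrite divr_gt0.
suff /(FM x _ _ rK0 rK) : separates x (r / K) r F.
  rewrite invf_div mulrCA divff ?gt_eqF // mulr1 /K expRK.
  by apply/negP; rewrite -ltNge ltr_pwDr // ler_norm.
apply: separates_disc_exterior => //.
- by rewrite predeqE => y; split=> // -[Fy yA]; apply: noy; exists y.
- by exists x; rewrite // edistxx ltW.
- have [rx|rx] := leP r (edist x0 x); first by exists x0.
  exists y0 => //; have := edist_triangle x x0 y0; rewrite (edistC x y0); lra.
Qed.

Lemma uniformly_perfect_cover_ge F : uniformly_perfect F ->
  exists s c : R, [/\ 0 < s, 0 < c &
    forall L, disc_cover L F -> c <= dim_sum s L].
Proof.
move=> upF; have [_ [x [_ [Fx _ _]]] _] := upF.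
have [K [r0 [K1 r0_gt0 FK]]] := uniformly_perfect_annulus upF.
have K8 : 1 < 8 * K by lra.
have s0 : 0 < ln 2 / ln (8 * K) by rewrite divr_gt0 // ln_gt0 // ltr1n.
exists (ln 2 / ln (8 * K)), (r0 `^ (ln 2 / ln (8 * K)) / 2); split=> //.
  by rewrite divr_gt0 // powR_gt0.
move=> L [L0 LF]; apply: (perfect_cover_ge K1 s0 _ FK Fx) => //; last first.
  by move=> z /LF.
rewrite /powR gt_eqF; last exact: lt_trans K8.
by rewrite divfK ?gt_eqF ?ln_gt0 // lnK // posrE.
Qed.

Lemma dimH_eq0_HNUP E : compact E -> dimH E = 0%E -> HNUP E.
Proof.
move=> cE dE; split=> // F FE _ /uniformly_perfect_cover_ge[s [c [s0 c0 Fc]]].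
have [|L EL] := @covers_of_dimH_eq0 _ _ s (c / 2) cE dE s0; first by rewrite divr_gt0.
have := Fc L (sub_disc_cover FE EL); lra.
Qed.

End UniformlyPerfect.

(** * Transfinite diameter *)

Section Capacity.
Variable R : realType.
Implicit Types (E F U : set (plane R)) (w x y z : plane R) (r s e h : R).

Definition pair_prod n (z : 'I_n -> plane R) : R :=
  \prod_(p : 'I_n * 'I_n | (p.1 < p.2)%N) edist (z p.1) (z p.2).

Lemma pair_prod_ge0 n (z : 'I_n -> plane R) : 0 <= pair_prod z.
Proof. by apply: prodr_ge0 => p _; exact: edist_ge0. Qed.

Lemma pair_prod_nat n (z : nat -> plane R) :
  pair_prod (fun i : 'I_n => z i) =
  \prod_(0 <= j < n) \prod_(0 <= i < j) edist (z i) (z j).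
Proof.
rewrite /pair_prod -(pair_big_dep xpredT (fun i j : 'I_n => (i < j)%N)
  (fun i j : 'I_n => edist (z i) (z j))) /=.
rewrite (exchange_big_dep xpredT) //= big_mkord; apply: eq_bigr => j _.
rewrite (big_nat_widen _ _ n) ?(ltnW (ltn_ord j)) //.
by rewrite big_mkord.
Qed.

Lemma max_prod_sup E n : compact E ->
  has_ubound [set pair_prod z | z in [set z : 'I_n -> plane R | forall i, E (z i)]].
Proof.
move=> /compact_edist_bounded[D D1 DE].
exists (\prod_(p : 'I_n * 'I_n | (p.1 < p.2)%N) D) => _ [z Ez <-].
by apply: ler_prod => p _; rewrite edist_ge0 DE.
Qed.

Lemma pair_prod_le_max E n (z : 'I_n -> plane R) : compact E ->
  (forall i, E (z i)) -> pair_prod z <= max_prod E n.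
Proof. by move=> cE Ez; apply: ub_le_sup; [exact: max_prod_sup|exists z]. Qed.

Lemma max_prod_ge0 E n : compact E -> 0 <= max_prod E n.
Proof.
move=> cE; rewrite /max_prod; set A := [set _ | _ in _].
have [->|/set0P[_ [z Ez _]]] := eqVneq A set0; first by rewrite sup0.
exact: le_trans (pair_prod_ge0 z) (pair_prod_le_max cE Ez).
Qed.

Lemma max_prod_le E n (B : R) : 0 <= B ->
  (forall z : 'I_n -> plane R, (forall i, E (z i)) -> pair_prod z <= B) ->
  max_prod E n <= B.
Proof.
move=> B0 EB; rewrite /max_prod; set A := [set _ | _ in _].
have [->|/set0P A0] := eqVneq A set0; first by rewrite sup0.
by apply: ge_sup => // _ [z Ez <-]; exact: EB.
Qed.

Lemma pair_prod_lift n (z : 'I_n.+1 -> plane R) i :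
  pair_prod (z \o lift i) =
  \prod_(p : 'I_n.+1 * 'I_n.+1 | [&& (p.1 < p.2)%N, p.1 != i & p.2 != i])
     edist (z p.1) (z p.2).
Proof.
rewrite /pair_prod (reindex_omap (fun p => (lift i p.1, lift i p.2)) (fun p =>
  if unlift i p.1 is Some a then omap (pair a) (unlift i p.2) else None)) /=.
  apply: eq_bigl => -[a b] /=; rewrite !liftK /= eqxx andbT.
  by rewrite !(eq_sym _ i) !neq_lift !andbT !ltnNge leq_bump2.
move=> [a b] /and3P[/= _ ai bi].
case: unliftP ai => [a' ->|->]; last by rewrite eqxx.
by case: unliftP bi => [b' ->|->] //; rewrite eqxx.
Qed.

(** Each point is deleted in turn; a given pair survives all but two of the n + 1 deletions. *)
Lemma prod_pair_prod_lift n (z : 'I_n.+1 -> plane R) :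
  \prod_i pair_prod (z \o lift i) = pair_prod z ^+ n.-1.
Proof.
under eq_bigr do rewrite pair_prod_lift.
rewrite (exchange_big_dep (fun p : 'I_n.+1 * 'I_n.+1 => (p.1 < p.2)%N)) /=; last first.
  by move=> i p _ /andP[].
rewrite -prodrXl; apply: eq_bigr => p p12; rewrite prodr_const; congr (_ ^+ _).
have -> : #|[pred i | [&& (p.1 < p.2)%N, p.1 != i & p.2 != i]]| =
          #|~: [set p.1; p.2]|.
  by apply: eq_card => i; rewrite !inE p12 negb_or !(eq_sym i).
by rewrite cardsCs finset.setCK card_ord cards2 neq_ltn p12 subSS subn1.
Qed.

Lemma n_diam_ge0 E n : 0 <= n_diam E n.
Proof. exact: powR_ge0. Qed.

(** Fekete's argument: deleting each of m + 1 points in turn leaves m-point configurations, whence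
    P_(m+1)^(m-1) <= P_m^(m+1). *)
Lemma n_diam_decr E n : compact E -> n_diam E n.+3 <= n_diam E n.+2.
Proof.
move=> cE; set m := n.+2.
have m1 : 0 < m%:R - 1 :> R by rewrite /m -natr1 addrK ltr0n.
have m0 : 0 < m%:R :> R by rewrite ltr0n.
have P0 k := max_prod_ge0 k cE.
have : max_prod E m.+1 <= max_prod E m `^ (m.+1%:R / (m%:R - 1)).
  apply: max_prod_le; first exact: powR_ge0.
  move=> z Ez; rewrite powRrM powR_mulrn //.
  have zP : pair_prod z ^+ m.-1 <= max_prod E m ^+ m.+1.
    rewrite -prod_pair_prod_lift.
    have -> : max_prod E m ^+ m.+1 = \prod_(i < m.+1) max_prod E m.
      by rewrite prodr_const card_ord.
    apply: ler_prod => i _; rewrite pair_prod_ge0 pair_prod_le_max // => j.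
    exact: Ez.
  have mE : m.-1%:R = m%:R - 1 :> R by rewrite /m -[in RHS]natr1 addrK.
  have -> : pair_prod z = (pair_prod z ^+ m.-1) `^ (m%:R - 1)^-1.
    by rewrite -powR_mulrn ?pair_prod_ge0 // -powRrM mE divff ?lt0r_neq0 //
       powRr1 ?pair_prod_ge0.
  apply: ge0_ler_powR; rewrite ?nnegrE ?exprn_ge0 ?pair_prod_ge0 //.
  by rewrite invr_ge0 ltW.
have x0 : 0 <= 2 / (m.+1%:R * (m.+1%:R - 1)) :> R.
  by rewrite divr_ge0 // mulr_ge0 // -natr1 addrK ltW.
move=> PP; rewrite /n_diam; apply: le_trans (ge0_ler_powR x0 _ _ PP) _.
- by rewrite nnegrE.
- by rewrite nnegrE powR_ge0.
rewrite -powRrM le_eqVlt; apply/orP; left; apply/eqP; congr (_ `^ _).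
rewrite -!natr1 addrK; field.
by rewrite !gt_eqF //; lra.
Qed.

Lemma n_diam_cvg E : compact E -> n_diam E n @[n --> \oo] --> Cap E.
Proof.
move=> cE; have : cvgn (fun n => n_diam E (n + 2)%N).
  apply: nonincreasing_is_cvgn.
    by apply/nonincreasing_seqP => n; rewrite !addn2; exact: n_diam_decr.
  by exists 0 => _ [n _ <-]; exact: n_diam_ge0.
by move=> /cvg_ex[l]; rewrite cvg_shiftn => /cvgP.
Qed.

Lemma n_diam_mono E m n : compact E -> (2 <= m)%N -> (m <= n)%N ->
  n_diam E n <= n_diam E m.
Proof.
move=> cE m2 /subnK <-; elim: (n - m)%N => // k IH.
apply: le_trans IH; rewrite addSn; move: m2 => /subnK <-.
by rewrite addnA addn2; exact: n_diam_decr.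
Qed.

Lemma Cap_ge0 E : compact E -> 0 <= Cap E.
Proof.
move=> cE; apply: limr_ge; first exact/cvgP/n_diam_cvg.
by apply: nearW => n; exact: n_diam_ge0.
Qed.

Lemma Cap_le_n_diam E n : compact E -> (2 <= n)%N -> Cap E <= n_diam E n.
Proof.
move=> cE n2; apply: limr_le; first exact/cvgP/n_diam_cvg.
by exists n => // m /= nm; exact: n_diam_mono.
Qed.

Lemma Cap_ge E (c : R) : compact E ->
  (forall N, exists2 n, (N <= n)%N & c <= n_diam E n) -> c <= Cap E.
Proof.
move=> cE Ec; apply: limr_ge; first exact/cvgP/n_diam_cvg.
exists 2 => // N /= N2; have [n Nn cn] := Ec N.
exact: le_trans cn (n_diam_mono cE N2 Nn).
Qed.

End Capacity.

(** * Sets of capacity zero have dimension zero *)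

Section CapacityZero.
Variable R : realType.
Implicit Types (E F U : set (plane R)) (w x y z : plane R) (s e h : R).
Implicit Types (L : seq (plane R * R)).

Lemma n_diam_ge E n h : compact E -> (2 <= n)%N -> 0 < h ->
  h ^+ 'C(n, 2) <= max_prod E n -> h <= n_diam E n.
Proof.
move=> cE n2 h0 hP; rewrite /n_diam.
have n1 : 0 < n%:R - 1 :> R by rewrite subr_gt0 ltr1n.
have n0 : 0 < n%:R :> R by rewrite ltr0n (leq_trans _ n2).
have nn : 0 < 2 / (n%:R * (n%:R - 1)) :> R by rewrite divr_gt0 // mulr_gt0.
have -> : h = (h ^+ 'C(n, 2)) `^ (2 / (n%:R * (n%:R - 1))).
  rewrite -powR_mulrn ?ltW // -powRrM.
  have -> : 'C(n, 2)%:R = n%:R * (n%:R - 1) / 2 :> R.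
    apply: (mulIf (x := 2)); first by rewrite pnatr_eq0.
    rewrite divfK ?pnatr_eq0 // -natrM muln2 bin2 -[RHS]mulrC.
    rewrite -(natrB _ (ltnW n2)) -natrM subn1 even_halfK ?(mulnC n.-1) //.
    by rewrite oddM; case: (n) n0 => [|k]; rewrite ?ltxx //= andNb.
  by rewrite mulrA divfK ?pnatr_eq0 // divff ?powRr1 ?ltW // mulf_neq0 ?lt0r_neq0.
apply: ge0_ler_powR; rewrite ?nnegrE ?exprn_ge0 ?max_prod_ge0 //; exact: ltW.
Qed.

(* If no polynomial with zeros [z] is small on [E], a next point can always be
   chosen at large geometric mean distance from the previous ones (Leja points). *)
Lemma Leja_points E h : E !=set0 -> 0 < h ->
  (forall n (z : nat -> plane R), (0 < n)%N ->
    exists2 w, E w & h ^+ n <= \prod_(0 <= i < n) edist (z i) w) ->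
  forall n, exists2 z : nat -> plane R, forall i, E (z i) &
    h ^+ 'C(n, 2) <= \prod_(0 <= j < n) \prod_(0 <= i < j) edist (z i) (z j).
Proof.
move=> [x0 Ex0] h0 Eh; elim=> [|n [z Ez IH]].
  by exists (fun=> x0); rewrite // big_geq.
have [w Ew hw] : exists2 w, E w & h ^+ n <= \prod_(0 <= i < n) edist (z i) w.
  case: n {IH} => [|n]; last exact: Eh.
  by exists x0; rewrite // big_geq.
exists (fun i => if (i < n)%N then z i else w) => [i|]; first by case: ifP.
rewrite big_nat_recr //= ltnn binS bin1 exprD.
apply: ler_pM; rewrite ?exprn_ge0 ?(ltW h0) //.
  apply: le_trans IH _; rewrite le_eqVlt; apply/orP; left; apply/eqP.
  apply: eq_big_nat => j /andP[_ jn]; rewrite jn; apply: eq_big_nat => i /andP[_ ij].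
  by rewrite (ltn_trans ij jn).
apply: le_trans hw _; rewrite le_eqVlt; apply/orP; left; apply/eqP.
by apply: eq_big_nat => i /andP[_ ->].
Qed.

(** The product is the modulus at [w] of the monic polynomial with zeros [Z]. If each such
    polynomial exceeded h^n somewhere on [E], Leja points would give n-th diameters at least [h] for
    arbitrarily large n, and so capacity at least [h]. *)
Lemma Cap_eq0_lemniscate E h : compact E -> Cap E = 0 -> 0 < h ->
  exists2 Z : seq (plane R), (0 < size Z)%N &
    forall w, E w -> \prod_(q <- Z) edist q w <= h ^+ size Z.
Proof.
move=> cE C0 h0; apply: contrapT => noZ.
have [E0|/set0P E0] := eqVneq E set0.
  by apply: noZ; exists [:: (0, 0)] => // w; rewrite E0.
suff /(@Cap_ge R E h cE) : forall N, exists2 n, (N <= n)%N & h <= n_diam E n.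
  by rewrite C0; apply/negP; rewrite -ltNge.
move=> N; exists N.+2; first by rewrite -addn2 leq_addr.
apply: n_diam_ge => //.
have [|z Ez zh] := Leja_points E0 h0 _ N.+2.
  move=> n z n0; apply: contrapT => noW; apply: noZ.
  exists (mkseq z n); rewrite size_mkseq // => w Ew.
  rewrite /mkseq big_map leNgt; apply/negP => /ltW hw; apply: noW; exists w => //.
  by rewrite /index_iota subn0.
apply: le_trans zh _; rewrite -pair_prod_nat.
by apply: pair_prod_le_max => // i; exact: Ez.
Qed.

(** Take the largest k for which some disc of radius [r k] holds at least k zeros, discard its
    zeros, and repeat; the indices then sum to at most the number of zeros. A disc about [w] holding
    j zeros either shares one with the chosen disc, where maximality gives j <= k and distance at
    most 2 [r k], or keeps all its zeros for the recursion. *)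
Lemma greedy_discs (r : nat -> R) (Z : seq (plane R)) :
  (forall i j, (i <= j)%N -> r i <= r j) ->
  exists l : seq (plane R * nat), [/\ forall p, p \in l -> (0 < p.2)%N,
    (\sum_(p <- l) p.2 <= size Z)%N &
    forall w k, (0 < k)%N -> (k <= count (fun q => edist q w <= r k)%R Z)%N ->
      exists2 p, p \in l & edist w p.1 <= 2 * r p.2].
Proof.
move=> r_mono; have [n] := ubnP (size Z); elim: n Z => // n IH Z Zn.
pose P k := (0 < k)%N && `[< exists w, (k <= count (fun q => edist q w <= r k)%R Z)%N >].
have PZ k : P k -> (k <= size Z)%N.
  by move=> /andP[_ /asboolP[w]] /leq_trans; apply; exact: count_size.
have [exP|noP] := pselect (exists k, P k); last first.
  exists [::]; split=> //; first by rewrite big_nil.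
  by move=> w k k0 kw; exfalso; apply: noP; exists k; rewrite /P k0; apply/asboolP; exists w.
case: (ex_maxnP exP PZ) => k /andP[k0 /asboolP[c ck]] kmax.
pose Z' := [seq q <- Z | ~~ (edist q c <= r k)].
have szZ : (count (fun q => edist q c <= r k)%R Z + size Z' = size Z)%N.
  by rewrite size_filter (count_predC (fun q => edist q c <= r k)).
have [|l [l0 lZ' lw]] := IH Z'; first by lia.
exists ((c, k) :: l); split.
- by move=> p; rewrite inE => /orP[/eqP->|/l0].
- by rewrite big_cons /=; lia.
- move=> w j j0 jw.
  have jk : (j <= k)%N by apply: kmax; rewrite /P j0; apply/asboolP; exists w.
  have [/hasP[q qZ /andP[qw qc]]|/hasPn noq] :=
    boolP (has (fun q => (edist q w <= r j) && (edist q c <= r k)) Z).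
    exists (c, k); rewrite ?mem_head //=.
    have := edist_triangle q w c; rewrite (edistC w q).
    have := r_mono _ _ jk; lra.
  have [|p pl pw] := lw w j j0; last by exists p; rewrite // inE pl orbT.
  rewrite count_filter (leq_trans jw) // leq_eqVlt; apply/orP; left; apply/eqP.
  by apply: eq_in_count => q /noq /=; case: (edist q w <= r j).
Qed.

(** The hypothesis says that the k-th smallest entry exceeds [r k]. The induction removes an entry
    exceeding the last bound, and removal never increases the counts. *)
Lemma prod_gt_order_stat (r : nat -> R) (D : seq R) :
  (forall k, (0 < k <= size D)%N -> 0 <= r k) ->
  (forall k, (0 < k <= size D)%N -> (count (fun d => d <= r k)%R D < k)%N) ->
  \prod_(0 <= i < size D) r i.+1 <= \prod_(d <- D) d.
Proof.
have [n] := ubnP (size D); elim: n D => // n IH D Dn r0 Dr.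
case szD : (size D) => [|m]; first by rewrite (size0nil szD) big_geq // big_nil.
have [d dD rd] : exists2 d, d \in D & r m.+1 < d.
  apply/hasP; rewrite -[has _ _]negbK -all_predC; apply/negP => /allP allD.
  have := Dr m.+1; rewrite szD leqnn => /(_ isT); rewrite ltnNge => /negP; apply.
  rewrite -{1}szD -[X in (X <= _)%N]count_predT leq_eqVlt; apply/orP; left; apply/eqP.
  by apply: eq_in_count => x /allD /=; rewrite -leNgt => ->.
have szR : size (rem d D) = m by rewrite size_rem // szD.
rewrite big_nat_recr //= (big_rem d) //= mulrC.
apply: ler_pM; [by apply: r0; rewrite szD leqnn| |exact: ltW|].
  by rewrite big_mkord; apply: prodr_ge0 => i _; apply: r0; rewrite szD /= ltnW ?ltnS // ltnW.
rewrite -{1}szR; apply: IH; rewrite ?szR.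
- lia.
- by move=> k /andP[k0 km]; apply: r0; rewrite k0 szD ltnW.
- move=> k /andP[k0 km]; apply: leq_ltn_trans (Dr k _).
    by rewrite count_rem leq_subr.
  by rewrite k0 szD ltnW.
Qed.

(** A crude form of Stirling's formula, from (1 + 1/n)^n <= e. *)
Lemma expr_nat_le_fact n : n%:R ^+ n <= expR n%:R * n`!%:R :> R.
Proof.
elim: n => [|n IH]; first by rewrite expr0 expR0 mul1r.
have e1 : n.+1%:R ^+ n <= expR 1 * n%:R ^+ n :> R.
  case: n {IH} => [|n]; first by rewrite !expr0 mulr1 ltW // expR_gt1.
  have n0 : 0 < n.+1%:R :> R by rewrite ltr0n.
  have -> : n.+2%:R = (1 + n.+1%:R^-1) * n.+1%:R :> R.
    by rewrite mulrDl mul1r mulVf ?lt0r_neq0 // -natr1.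
  rewrite exprMn ler_pM2r ?exprn_gt0 //.
  have -> : expR 1 = expR n.+1%:R^-1 ^+ n.+1 :> R.
    by rewrite -expRM_natl mulfV ?lt0r_neq0.
  by rewrite lerXn2r ?nnegrE ?expR_ge0 ?expR_ge1Dx // addr_ge0.
rewrite exprS factS natrM mulrCA; apply: ler_wpM2l => //.
apply: le_trans e1 _; rewrite -natr1 addrC expRD -mulrA.
by rewrite ler_wpM2l ?expR_ge0.
Qed.

Lemma Cartan E s h (Z : seq (plane R)) : 0 < s -> 0 < h -> (0 < size Z)%N ->
  (forall w, E w -> \prod_(q <- Z) edist q w <= h ^+ size Z) ->
  exists2 L, disc_cover L E & dim_sum s L <= 3 `^ s * (expR 2 * h `^ s).
Proof.
move=> s0 h0; set n := size Z => n0 EZ.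
have nR : 0 < n%:R :> R by rewrite ltr0n.
(* The s-th powers are proportional to k, so their total is controlled by the indices of the greedy
   discs, which sum to at most n. The s-th power of r_1 ... r_n is (e^2 h^s)^n n!/n^n; since n!/n^n
   >= e^(-n), the constant e^2 makes the product strictly larger than h^n. *)
pose r k := (expR 2 * h `^ s * (k%:R / n%:R)) `^ s^-1.
have A0 : 0 < expR 2 * h `^ s by rewrite mulr_gt0 ?expR_gt0 ?powR_gt0.
have rs k : r k `^ s = expR 2 * h `^ s * (k%:R / n%:R).
  by rewrite -powRrM mulVf ?gt_eqF // powRr1 // mulr_ge0 ?divr_ge0 // ltW.
have r_gt0 k : (0 < k)%N -> 0 < r k.
  by move=> k0; rewrite powR_gt0 // mulr_gt0 // divr_gt0 // ltr0n.
have r_mono i j : (i <= j)%N -> r i <= r j.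
  move=> ij; have Ak k : 0 <= expR 2 * h `^ s * (k%:R / n%:R).
    by rewrite mulr_ge0 ?divr_ge0 // ltW.
  apply: ge0_ler_powR; rewrite ?nnegrE ?Ak // ?invr_ge0 ?(ltW s0) //.
  by rewrite ler_pM2l // ler_pM2r ?invr_gt0 // ler_nat.
have prod_r : h ^+ n < \prod_(0 <= i < n) r i.+1.
  have prod_rs : (\prod_(0 <= i < n) r i.+1) `^ s =
      (expR 2 * h `^ s) ^+ n * (n`!%:R / n%:R ^+ n).
    have -> : (\prod_(0 <= i < n) r i.+1) `^ s = \prod_(0 <= i < n) (r i.+1 `^ s).
      elim: (n) => [|m IH]; first by rewrite !big_geq ?powR1.
      rewrite !big_nat_recr //= powRM ?IH ?powR_ge0 //.
      by apply: prodr_ge0 => i _; exact: powR_ge0.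
    under eq_bigr do rewrite rs.
    rewrite !big_split /= !prodr_const_nat subn0 -exprVn; congr (_ * (_ * _)).
      by rewrite exprMn.
    by rewrite -natr_prod fact_prod big_add1.
  have hn : (h ^+ n) `^ s < (\prod_(0 <= i < n) r i.+1) `^ s.
    rewrite prod_rs exprMn -[ltLHS]mul1r.
    have -> : (h ^+ n) `^ s = (h `^ s) ^+ n.
      by rewrite -powR_mulrn ?(ltW h0) // powRAC powR_mulrn ?powR_ge0.
    rewrite mulrAC ltr_pM2r ?exprn_gt0 ?powR_gt0 //.
    rewrite mulrA ltr_pdivlMr ?exprn_gt0 // mul1r.
    apply: le_lt_trans (expr_nat_le_fact n) _.
    rewrite ltr_pM2r ?ltr0n ?fact_gt0 // -expRM_natl ltr_expR.
    by rewrite ltr_pMr ?ltr1n.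
  rewrite ltNge; apply/negP => le_h; move: hn; apply/negP; rewrite -leNgt.
  apply: ge0_ler_powR; rewrite ?nnegrE ?exprn_ge0 ?(ltW h0) ?(ltW s0) ?(ltW le_h) //.
  by apply: prodr_ge0 => i _; rewrite ltW // r_gt0.
have [l [l0 lZ lw]] := greedy_discs Z r_mono.
(* Factor 3 instead of 2, because the discs of a cover are open. *)
exists [seq (p.1, 3 * r p.2) | p <- l].
  split=> [_ /mapP[p pl ->] /=|w Ew]; first by rewrite mulr_gt0 // r_gt0 // l0.
  suff [k /andP[k0 kn] kw] : exists2 k, (0 < k <= n)%N &
      (k <= count (fun q => edist q w <= r k)%R Z)%N.
    have [p pl pw] := lw w k k0 kw.
    exists (p.1, 3 * r p.2); first exact: (map_f (fun p => (p.1, 3 * r p.2))).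
    by rewrite /disc /=; have := r_gt0 _ (l0 _ pl); lra.
  apply: contrapT => nok; have := EZ w Ew; apply/negP; rewrite -ltNge.
  apply: (lt_le_trans prod_r).
  rewrite -(big_map (fun q => edist q w) xpredT id) /=.
  rewrite /n -(size_map (fun q => edist q w)); apply: prod_gt_order_stat.
    by move=> k /andP[k0 _]; rewrite ltW // r_gt0.
  move=> k; rewrite size_map => kn; rewrite count_map ltnNge; apply/negP => kw.
  by apply: nok; exists k.
rewrite /dim_sum big_map /=.
have -> : \sum_(p <- l) (3 * r p.2) `^ s =
    3 `^ s * (expR 2 * h `^ s) * ((\sum_(p <- l) p.2)%N%:R / n%:R).
  rewrite natr_sum mulr_suml mulr_sumr; apply: eq_bigr => p _.
  by rewrite powRM // ?powR_ge0 // rs !mulrA.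
rewrite ler_piMr ?mulr_ge0 ?powR_ge0 ?expR_ge0 //.
by rewrite ler_pdivrMr // mul1r ler_nat.
Qed.

Lemma Cap_eq0_dimH E : compact E -> Cap E = 0 -> dimH E = 0%E.
Proof.
move=> cE C0; apply: dimH_eq0_of_covers => s e s0 e0.
(* This makes the bound of [Cartan] equal to [e]. *)
pose h := (e / (3 `^ s * expR 2)) `^ s^-1.
have d0 : 0 < 3 `^ s * expR 2 :> R by rewrite mulr_gt0 ?powR_gt0 ?expR_gt0.
have h0 : 0 < h by rewrite powR_gt0 // divr_gt0.
have [Z Z0 EZ] := Cap_eq0_lemniscate cE C0 h0.
have [L EL Ls] := Cartan s0 h0 Z0 EZ; exists L => //.
apply: le_trans Ls _; rewrite mulrA -powRrM mulVf ?gt_eqF // powRr1.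
  by rewrite mulrC divfK ?gt_eqF.
by rewrite divr_ge0 ?ltW.
Qed.

End CapacityZero.

(** * Plane measure *)

Section PlaneMeasure.
Variable R : realType.
Implicit Types (A E F U : set (plane R)) (w x y z : plane R) (r s e h : R).
Implicit Types (p q : plane R * R).

Definition csq (p : plane R * R) : set (plane R) :=
  [set` `[p.1.1, p.1.1 + p.2]] `*` [set` `[p.1.2, p.1.2 + p.2]].

Lemma csqP (p : plane R * R) x : csq p x <->
  (p.1.1 <= x.1 <= p.1.1 + p.2) /\ (p.1.2 <= x.2 <= p.1.2 + p.2).
Proof. by rewrite /csq /= !in_itv. Qed.

Lemma measurable_csq p : measurable (csq p).
Proof. exact: measurableX. Qed.

Lemma m2_csq (p : plane R * R) : 0 <= p.2 -> m2 (csq p) = (p.2 ^+ 2)%:E.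
Proof.
move=> p0; rewrite /m2 product_measure1E //.
apply: etrans (congr2 mule (lebesgue_measure_itv _) (lebesgue_measure_itv _)) _ => /=.
rewrite !lte_fin !ltrDl; case: ifP => [_|/negbT].
  by rewrite -!EFinD !(addrC _ p.2) !addrK -EFinM expr2.
by rewrite -leNgt => p0'; have -> : p.2 = 0 by lra; rewrite mul0e expr0n.
Qed.

(** The sigma-algebra is that of the product, so [E] is written as a countable intersection of
    countable unions of squares: at mesh 1/(n+1), those that meet [E]. A point in all these unions
    is a limit of points of [E]. *)
Lemma compact_measurable_plane E : compact E -> measurable E.
Proof.
move=> cE; have clE := compact_closed (@plane_hausdorff R) cE.
pose cell (n : nat) (ij : int * int) : plane R * R :=
  ((ij.1%:~R / n.+1%:R, ij.2%:~R / n.+1%:R), n.+1%:R^-1).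
suff -> : E = \bigcap_n \bigcup_ij
    (if `[< csq (cell n ij) `&` E !=set0 >] then csq (cell n ij) else set0).
  apply: bigcapT_measurable => n; apply: countable_bigcupT_measurable => [|ij].
    exact: countableP.
  by case: ifP => _; [exact: measurable_csq|exact: measurable0].
have floor_cell n (t : R) : (Num.floor (t * n.+1%:R))%:~R / n.+1%:R <= t <=
    (Num.floor (t * n.+1%:R))%:~R / n.+1%:R + n.+1%:R^-1.
  rewrite -[X in _ + X]mul1r -mulrDl ler_pdivrMr ?ltr0n // ler_pdivlMr ?ltr0n //.
  by rewrite Num.Theory.floor_le_tmp //= -intrD1 ltW // floorD1_gt.
apply/seteqP; split=> [x Ex n _|x xC].
  pose ij := (Num.floor (x.1 * n.+1%:R), Num.floor (x.2 * n.+1%:R)).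
  have xij : csq (cell n ij) x by apply/csqP; split; exact: floor_cell.
  by exists ij => //; case: asboolP => // -[]; exists x.
apply: clE => B /nbhs_ballP[e /= e0 xB].
pose n := Num.truncn e^-1.
have [ij _] := xC n I.
case: asboolP => // -[y [yij Ey]] xij; exists y; split=> //; apply: xB.
have ne : n.+1%:R^-1 < e.
  by rewrite invf_plt ?posrE ?ltr0n // truncnS_gt // invr_ge0 ltW.
move: yij xij => /csqP[] /= + + /csqP[] /=; 
move: (_ / _) (_ / _) => a b; move: n.+1%:R^-1 ne => d de.
move=> /andP[y1 y1'] /andP[y2 y2'] /andP[x1 x1'] /andP[x2 x2'].
by split; rewrite /ball /= ltr_norml; apply/andP; split; lra.
Qed.

Lemma m2_le_squares A (l : seq (plane R * R)) : measurable A ->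
  (forall p, p \in l -> 0 <= p.2) ->
  (forall x, A x -> exists2 p, p \in l & csq p x) ->
  (m2 A <= (\sum_(p <- l) p.2 ^+ 2)%:E)%E.
Proof.
elim: l A => [|p l IH] A mA l0 Al.
  have -> : A = set0 by apply/seteqP; split=> // x /Al[].
  by rewrite big_nil /m2 measure0.
rewrite big_cons EFinD -m2_csq; last by apply: l0; rewrite mem_head.
have mp := measurable_csq p.
apply: (@le_trans _ _ (m2 (csq p `|` (A `\` csq p)))).
  apply: le_measure; rewrite ?inE //.
    by apply: measurableU => //; exact: measurableD.
  by move=> x Ax; have [px|px] := pselect (csq p x); [left|right].
apply: le_trans (measureU2 _ _ _) _ => //; first exact: measurableD.
apply: leeD => //; apply: IH; first exact: measurableD.
  by move=> q ql; apply: l0; rewrite inE ql orbT.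
move=> x [/Al[q]]; rewrite inE => /orP[/eqP->|ql qx _] //.
by exists q.
Qed.

Lemma m2_eq0 A : (forall e, 0 < e -> (m2 A <= e%:E)%E) -> m2 A = 0%E.
Proof.
move=> A0; apply/eqP; rewrite eq_le measure_ge0 andbT.
by apply/lee_addgt0Pr => e e0; rewrite add0e; exact: A0.
Qed.

Lemma dimH_eq0_m2 E : compact E -> dimH E = 0%E -> m2 E = 0%E.
Proof.
move=> cE dE; apply: m2_eq0 => e e0.
have e4 : 0 < e / 4 by rewrite divr_gt0.
have [//|L [L0 EL] Le] := covers_of_dimH_eq0 (s := 2) cE dE _ e4.
pose sq (p : plane R * R) : plane R * R := ((p.1.1 - p.2, p.1.2 - p.2), 2 * p.2).
apply: le_trans (m2_le_squares (l := map sq L) _ _ _) _.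
- exact: compact_measurable_plane.
- by move=> _ /mapP[p pL ->] /=; rewrite mulr_ge0 // ltW // L0.
- move=> x /EL[p pL px]; exists (sq p); first exact: map_f.
  have := le_edist1 x p.1; have := le_edist2 x p.1; move: px; rewrite /disc /=.
  by rewrite !ler_norml => xp /andP[h1 h2] /andP[h3 h4]; apply/csqP => /=;
     split; apply/andP; split; lra.
rewrite lee_fin big_map /=.
under eq_bigr do rewrite exprMn.
rewrite -mulr_sumr.
have -> : \sum_(p <- L) p.2 ^+ 2 = dim_sum 2 L.
  by apply: eq_big_seq => p /L0 p0; rewrite -powR_mulrn // ltW.
by rewrite -[leRHS](divfK (x := 4)) // mulrC -natrX ler_pM2r.
Qed.

(** * Subdivided squares and the area of porous sets *)

Definition subsq N (p : plane R * R) (ij : 'I_N * 'I_N) : plane R * R :=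
  ((p.1.1 + ij.1%:R * (p.2 / N%:R), p.1.2 + ij.2%:R * (p.2 / N%:R)), p.2 / N%:R).

Lemma subinterval N (h t : R) : 0 <= t -> t <= N.+1%:R * h ->
  exists i : 'I_N.+1, i%:R * h <= t <= i%:R * h + h.
Proof.
move=> t0; elim: N => [|N IH] tN.
  by exists ord0; rewrite mul0r t0 add0r -[h]mul1r.
have [/IH[i it]|tN'] := leP t (N.+1%:R * h).
  by exists (widen_ord (leqnSn _) i).
exists ord_max; rewrite /= ltW // -[X in _ + X]mul1r -mulrDl.
by rewrite (natrD _ 1 N.+1) addrC in tN *.
Qed.

Lemma csq_subsq N p x : (0 < N)%N -> csq p x -> exists ij : 'I_N * 'I_N, csq (subsq p ij) x.
Proof.
case: N => // N _ /csqP[/andP[a1 b1] /andP[a2 b2]].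
have N0 : N.+1%:R != 0 :> R by rewrite pnatr_eq0.
have [||i /andP[i1 i2]] := @subinterval N (p.2 / N.+1%:R) (x.1 - p.1.1).
- by rewrite subr_ge0.
- by rewrite mulrC divfK //; lra.
have [||j /andP[j1 j2]] := @subinterval N (p.2 / N.+1%:R) (x.2 - p.1.2).
- by rewrite subr_ge0.
- by rewrite mulrC divfK //; lra.
exists (i, j); apply/csqP; rewrite /subsq /=.
split; apply/andP; split.
- by rewrite -lerBrDl.
- by rewrite -addrA -lerBlDl.
- by rewrite -lerBrDl.
- by rewrite -addrA -lerBlDl.
Qed.

Lemma csq_edist p x y : csq p x -> csq p y -> edist x y <= 2 * p.2.
Proof.
move=> /csqP[/andP[a1 b1] /andP[a2 b2]] /csqP[/andP[c1 d1] /andP[c2 d2]].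
apply: le_trans (edist_le_add x y) _.
have -> : 2 * p.2 = p.2 + p.2 by ring.
by apply: lerD; rewrite ler_norml; apply/andP; split; lra.
Qed.

Lemma sum_subsq N p (k : 'I_N * 'I_N) : (0 < N)%N ->
  \sum_(q <- [seq subsq p ij | ij <- enum (predC1 k)]) q.2 ^+ 2 =
  (1 - (N%:R ^+ 2)^-1) * p.2 ^+ 2.
Proof.
move=> N0; have NR : N%:R != 0 :> R by rewrite pnatr_eq0 -lt0n.
rewrite big_map big_enum /= sumr_const cardC1 card_prod card_ord.
rewrite -[LHS]mulr_natr -subn1 natrB ?muln_gt0 ?N0 // natrM.
by field.
Qed.

(** Porosity gives holes only near points of [E], so the cell of the centre of [p] is tried first.
    If it contains a point [a] of [E], the hole in the disc of radius p.2/4 about [a] has its centre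
    within p.2/2 of the centre of [p], as N > 8, hence in [p]. The cell of that point has diameter
    at most 2 p.2/N, less than the radius c p.2/4 as N c > 8. *)
Lemma porous_hole E (c : R) N p : 0 < p.2 -> 0 < c -> (8 < N)%N -> 8 < N%:R * c ->
  (forall a r, E a -> 0 < r ->
    exists2 b, disc b (c * r) `<=` disc a r & disc b (c * r) `&` E = set0) ->
  exists ij : 'I_N * 'I_N, csq (subsq p ij) `&` E = set0.
Proof.
move=> p0 c0 N8 Nc Ec.
have N0 : (0 < N)%N by apply: ltn_trans N8.
have NR : 0 < N%:R :> R by rewrite ltr0n.
pose h := p.2 / N%:R.
have h0 : 0 < h by rewrite divr_gt0.
have hN : p.2 = N%:R * h by rewrite mulrC divfK ?gt_eqF.
pose z : plane R := (p.1.1 + p.2 / 2, p.1.2 + p.2 / 2).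
have [|k kz] := @csq_subsq N p z N0.
  by apply/csqP => /=; split; apply/andP; split; lra.
apply: contrapT => noij.
have [a [ka Ea]] : csq (subsq p k) `&` E !=set0.
  by apply/set0P/eqP => k0; apply: noij; exists k.
have az : edist a z <= 2 * h by have := csq_edist ka kz.
have h4 : 8 * h < p.2 by rewrite hN ltr_pM2r // (ltr_nat _ 8).
have [|b bsub bE] := Ec a (p.2 / 4) Ea; first by rewrite divr_gt0.
have bz : edist b z < p.2 / 2.
  have : disc a (p.2 / 4) b.
    by apply: bsub; rewrite /disc /= edistxx mulr_gt0 // divr_gt0.
  by have := edist_triangle a b z; rewrite /disc /=; lra.
have [|ij bij] := @csq_subsq N p b N0.
  move: (le_edist1 b z) (le_edist2 b z); rewrite !ler_norml /=.
  move=> /andP[? ?] /andP[? ?].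
  by apply/csqP; split; apply/andP; split; lra.
apply: noij; exists ij; apply/seteqP; split=> // x [xij Ex]; rewrite -bE; split=> //.
rewrite /disc /=; apply: le_lt_trans (csq_edist xij bij) _; rewrite /= -/h hN.
have -> : c * (N%:R * h / 4) = N%:R * c / 4 * h by ring.
by rewrite ltr_pM2r //; lra.
Qed.

Lemma square_covers E (rho : R) : 
  (forall p, 0 < p.2 -> exists l : seq (plane R * R), [/\ forall q, q \in l -> 0 < q.2,
     \sum_(q <- l) q.2 ^+ 2 = rho * p.2 ^+ 2 &
     forall x, E x -> csq p x -> exists2 q, q \in l & csq q x]) ->
  forall n p, 0 < p.2 -> exists l : seq (plane R * R), [/\ forall q, q \in l -> 0 < q.2,
     \sum_(q <- l) q.2 ^+ 2 = rho ^+ n * p.2 ^+ 2 &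
     forall x, E x -> csq p x -> exists2 q, q \in l & csq q x].
Proof.
move=> Erho; elim=> [|n IH] p p0.
  exists [:: p]; split; first by move=> q; rewrite inE => /eqP->.
    by rewrite big_seq1 expr0 mul1r.
  by move=> x _ px; exists p; rewrite ?mem_head.
have [l [l0 lsum lE]] := IH p p0.
suff [l' [l0' lsum' lE']] : exists l' : seq (plane R * R), [/\ forall q, q \in l' -> 0 < q.2,
     \sum_(q <- l') q.2 ^+ 2 = rho * \sum_(q <- l) q.2 ^+ 2 &
     forall x, E x -> (exists2 q, q \in l & csq q x) -> exists2 q, q \in l' & csq q x].
  exists l'; split=> //; first by rewrite lsum' lsum (exprS rho) mulrA.
  by move=> x Ex px; apply: lE' => //; exact: lE.
elim: l l0 {lsum lE} => [|q l IHl] l0.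
  by exists [::]; split=> [||x _ []] //; rewrite !big_nil mulr0.
have [|l1 [l10 l1sum l1E]] := IHl; first by move=> q' ql; apply: l0; rewrite inE ql orbT.
have [|l2 [l20 l2sum l2E]] := Erho q; first by apply: l0; rewrite mem_head.
exists (l2 ++ l1); split.
- by move=> q'; rewrite mem_cat => /orP[/l20|/l10].
- by rewrite big_cat big_cons /= l2sum l1sum mulrDr.
- move=> x Ex [q']; rewrite inE => /orP[/eqP->|q'l] q'x.
    by have [q2 q2l ?] := l2E x Ex q'x; exists q2; rewrite // mem_cat q2l.
  have [|q2 q2l ?] := l1E x Ex; first by exists q'.
  by exists q2; rewrite // mem_cat q2l orbT.
Qed.

Lemma exists_small_expr (rho e : R) : 0 <= rho -> rho < 1 -> 0 < e ->
  exists n, rho ^+ n < e.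
Proof.
move=> rho0 rho1 e0.
have : rho ^+ n @[n --> \oo] --> 0 by apply: cvg_expr; rewrite ger0_norm.
move=> /cvgrPdist_lt/(_ e e0)[n _ /(_ n (leqnn n))].
by rewrite /= sub0r normrN ger0_norm ?exprn_ge0 //; exists n.
Qed.

Lemma porous_m2 E : porous E -> m2 E = 0%E.
Proof.
move=> [cE [c c0 Ec]]; apply: m2_eq0 => e e0.
have [D D1 ED] := compact_edist_bounded cE.
have [E0|/set0P[x0 Ex0]] := eqVneq E set0; first by rewrite E0 /m2 measure0 lee_fin ltW.
pose N := (Num.truncn (8 / c) + 9)%N.
have N8 : (8 < N)%N by rewrite /N addnS ltnS leq_addl.
have Nc : 8 < N%:R * c.
  rewrite -ltr_pdivrMr //; apply: lt_le_trans (truncnS_gt _) _.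
  by rewrite ler_nat /N -addn1 leq_add2l.
have N0 : (0 < N)%N by apply: ltn_trans N8.
have N1 : 1 < N%:R ^+ 2 :> R by rewrite -natrX ltr1n -(exp1n 2) ltn_exp2r // (ltn_trans _ N8).
pose rho : R := 1 - (N%:R ^+ 2)^-1.
have N20 : 0 < N%:R ^+ 2 :> R by exact: lt_trans N1.
have rho0 : 0 <= rho by rewrite subr_ge0 invf_le1 // ltW.
have rho1 : rho < 1 by rewrite gtrBl invr_gt0.
have [|n rn] := @exists_small_expr rho (e / (2 * D) ^+ 2) rho0 rho1.
  by rewrite divr_gt0 // exprn_gt0 // mulr_gt0 // (lt_le_trans _ D1).
pose p0 : plane R * R := ((x0.1 - D, x0.2 - D), 2 * D).
have [||l [l0 lsum lE]] := @square_covers E rho _ n p0.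
- move=> p p_gt0; have [k kE] := porous_hole p_gt0 c0 N8 Nc Ec.
  exists [seq subsq p ij | ij <- enum (predC1 k)]; split.
  + by move=> _ /mapP[ij _ ->]; rewrite divr_gt0 // ltr0n.
  + by rewrite sum_subsq.
  + move=> x Ex /(csq_subsq N0)[ij ijx]; exists (subsq p ij) => //.
    apply: map_f; rewrite mem_enum /= inE; apply/eqP => ijk; rewrite ijk in ijx.
    by have : (csq (subsq p k) `&` E) x by []; rewrite kE.
- by rewrite mulr_gt0 // (lt_le_trans _ D1).
apply: le_trans (m2_le_squares (l := l) _ _ _) _.
- exact: compact_measurable_plane.
- by move=> q /l0/ltW.
- move=> x Ex; apply: lE => //; apply/csqP => /=.
  have := le_trans (le_edist1 x x0) (ED _ _ Ex Ex0).
  have := le_trans (le_edist2 x x0) (ED _ _ Ex Ex0).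
  by rewrite !ler_norml => /andP[? ?] /andP[? ?]; split; apply/andP; split; lra.
rewrite lee_fin lsum ltW // -ltr_pdivlMr // exprn_gt0 // mulr_gt0 //.
exact: lt_le_trans D1.
Qed.

End PlaneMeasure.

(** * An HNUP set of positive measure *)

Section FatHNUP.
Variable R : realType.
Implicit Types (A E F U : set (plane R)) (w x y z : plane R) (r s e h : R).
Implicit Types (p q : plane R * R).

Definition osq p : set (plane R) :=
  [set x | (p.1.1 < x.1 < p.1.1 + p.2) /\ (p.1.2 < x.2 < p.1.2 + p.2)].

Lemma osq_csq p : osq p `<=` csq p.
Proof.
by move=> x [/andP[? ?] /andP[? ?]]; apply/csqP; split; apply/andP; split; exact: ltW.
Qed.

Lemma closed_csq p : closed (csq p).
Proof.
apply: compact_closed; first exact: plane_hausdorff.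
by apply: compact_setX; exact: segment_compact.
Qed.

Lemma open_closed_interval_disjoint (i j : nat) (h t : R) : 0 < h ->
  i%:R * h < t < i%:R * h + h -> j%:R * h <= t <= j%:R * h + h -> i = j.
Proof.
move=> h0 /andP[a b] /andP[c d].
have E k : k%:R * h + h = k.+1%:R * h :> R by rewrite -natr1 mulrDl mul1r.
apply/eqP; rewrite eqn_leq -[(i <= j)%N]ltnS -[(j <= i)%N]ltnS.
have := lt_le_trans a d; rewrite E ltr_pM2r // ltr_nat => ->.
by have := le_lt_trans c b; rewrite E ltr_pM2r // ltr_nat => ->.
Qed.

Lemma osq_subsq_disjoint N p (ij kl : 'I_N * 'I_N) x : 0 < p.2 ->
  osq (subsq p ij) x -> csq (subsq p kl) x -> ij = kl.
Proof.
case: ij kl => [i j] [k l] p0.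
have N0 : (0 < N)%N by apply: leq_ltn_trans (ltn_ord i).
have h0 : 0 < p.2 / N%:R by rewrite divr_gt0 // ltr0n.
move=> [/andP[a1 b1] /andP[a2 b2]] /csqP[/andP[c1 d1] /andP[c2 d2]].
rewrite /subsq /= in a1 b1 a2 b2 c1 d1 c2 d2.
congr pair; apply: val_inj => /=.
  apply: (@open_closed_interval_disjoint _ _ _ (x.1 - p.1.1) h0).
    by apply/andP; split; [rewrite ltrBrDl|rewrite ltrBlDl addrA].
  by apply/andP; split; [rewrite lerBrDl|rewrite lerBlDl addrA].
apply: (@open_closed_interval_disjoint _ _ _ (x.2 - p.1.2) h0).
  by apply/andP; split; [rewrite ltrBrDl|rewrite ltrBlDl addrA].
by apply/andP; split; [rewrite lerBrDl|rewrite lerBlDl addrA].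
Qed.

Lemma subinterval_sub N (i : 'I_N) (a s t : R) : 0 < s ->
  a + i%:R * (s / N%:R) < t < a + i%:R * (s / N%:R) + s / N%:R -> a < t < a + s.
Proof.
move=> s0 /andP[it ti].
have N0 : (0 < N)%N by apply: leq_ltn_trans (ltn_ord i).
have h0 : 0 < s / N%:R by rewrite divr_gt0 // ltr0n.
have sE : s = N%:R * (s / N%:R) by rewrite mulrC divfK // pnatr_eq0 -lt0n.
apply/andP; split.
  by apply: le_lt_trans it; rewrite lerDl mulr_ge0 // ltW.
apply: lt_le_trans ti _; rewrite -addrA lerD2l {3}sE -{2}[s / _]mul1r -mulrDl.
by rewrite ler_pM2r // natr1 ler_nat.
Qed.

Lemma osq_subsq N p (ij : 'I_N * 'I_N) : 0 < p.2 -> osq (subsq p ij) `<=` osq p.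
Proof. by move=> p0 x [h1 h2]; split; exact: subinterval_sub h1 || exact: subinterval_sub h2. Qed.

Definition center m : 'I_m.*2.+1 * 'I_m.*2.+1 := (inord m, inord m).

(** With an odd number 2m + 1 of subdivisions there is a central cell. It is kept whole, the other
    cells are treated in the same way for [n] rounds, and what is then still undecided is
    dropped. *)
Fixpoint nest m n p : set (plane R) :=
  if n is n'.+1 then
    csq (subsq p (center m)) `|`
    \bigcup_(ij in [set ij : 'I_m.*2.+1 * 'I_m.*2.+1 | ij != center m])
       nest m n' (subsq p ij)
  else set0.

Lemma nest_closed m n p : closed (nest m n p).
Proof.
elim: n p => [|n IH] p /=; first exact: closed0.
apply: closedU; first exact: closed_csq.
by apply: closed_bigcup => [|ij _]; [exact: finite_finset|exact: IH].
Qed.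

Lemma subsq_gt0 N p (ij : 'I_N * 'I_N) : 0 < p.2 -> 0 < (subsq p ij).2.
Proof.
by move=> p0; rewrite /= divr_gt0 // ltr0n; apply: leq_ltn_trans (ltn_ord ij.1).
Qed.

Lemma mid_subinterval m (a s t : R) : (0 < m)%N -> 0 < s ->
  let h := s / m.*2.+1%:R in
  a + m%:R * h <= t <= a + m%:R * h + h ->
  a < t < a + s /\ `|t - (a + s / 2)| <= h / 2.
Proof.
move=> m0 s0 h /andP[h1 h2].
have h0 : 0 < h by rewrite divr_gt0 // ltr0n.
have mh : h <= m%:R * h by rewrite ler_peMl ?ler1n // ltW.
have sE : s = 2 * (m%:R * h) + h.
  have -> : s = m.*2.+1%:R * h by rewrite mulrC divfK // pnatr_eq0.
  by rewrite -natr1 -muln2 natrM; ring.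
move: h1 h2 mh h0; move: (m%:R * h) sE => mh ->  h1 h2 mhh h0.
by split; [apply/andP; split; lra|rewrite ler_norml; apply/andP; split; lra].
Qed.

Definition mid p : plane R := (p.1.1 + p.2 / 2, p.1.2 + p.2 / 2).

Lemma csq_center m p x : (0 < m)%N -> 0 < p.2 -> csq (subsq p (center m)) x ->
  osq p x /\ edist x (mid p) <= p.2 / m.*2.+1%:R.
Proof.
move=> m0 p0 /csqP[]; rewrite /subsq /= inordK; last by rewrite -addnn ltnS leq_addr.
move=> /(mid_subinterval m0 p0)[a1 b1] /(mid_subinterval m0 p0)[a2 b2].
split; first by split.
apply: le_trans (edist_le_add _ _) _; rewrite /mid /= [leRHS]splitr.
exact: lerD.
Qed.

Lemma nest_osq m n p : (0 < m)%N -> 0 < p.2 -> nest m n p `<=` osq p.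
Proof.
move=> m0; elim: n p => [|n IH] p p0 //= x [/(csq_center m0 p0)[]//|[ij _ xij]].
exact/(osq_subsq p0)/IH/xij/subsq_gt0.
Qed.

(** Each round keeps the fraction 1/(2m+1)^2 of the area still undecided. For fixed [m], that is for
    a fixed thickness of the gaps, the lost area thus tends to 0 as [n] grows. *)
Lemma nest_cover m n p : 0 < p.2 -> exists l : seq (plane R * R),
  [/\ forall q, q \in l -> 0 < q.2,
     \sum_(q <- l) q.2 ^+ 2 = (1 - (m.*2.+1%:R ^+ 2)^-1) ^+ n * p.2 ^+ 2 &
     forall x, csq p x -> ~ nest m n p x -> exists2 q, q \in l & csq q x].
Proof.
elim: n p => [|n IH] p p0.
  exists [:: p]; split; first by move=> q; rewrite inE => /eqP->.
    by rewrite big_seq1 expr0 mul1r.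
  by move=> x px _; exists p; rewrite ?mem_head.
have /choice[f fP] : forall q, exists l : seq (plane R * R), 0 < q.2 ->
    [/\ forall q', q' \in l -> 0 < q'.2,
     \sum_(q' <- l) q'.2 ^+ 2 = (1 - (m.*2.+1%:R ^+ 2)^-1) ^+ n * q.2 ^+ 2 &
     forall x, csq q x -> ~ nest m n q x -> exists2 q', q' \in l & csq q' x].
  move=> q; have [q0|q0] := ltP 0 q.2; last by exists [::].
  by have [l lP] := IH q q0; exists l.
pose cs := [seq subsq p ij | ij <- enum (predC1 (center m))].
have cs0 q : q \in cs -> 0 < q.2 by move=> /mapP[ij _ ->]; exact: subsq_gt0.
exists (flatten [seq f q | q <- cs]); split.
- move=> q /flattenP[_ /mapP[q' /cs0 q'0 ->]] qf.
  by have [+ _ _] := fP q' q'0; apply.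
- rewrite big_flatten big_map /=.
  rewrite (eq_big_seq (fun q => (1 - (m.*2.+1%:R ^+ 2)^-1) ^+ n * q.2 ^+ 2)).
    by rewrite -mulr_sumr sum_subsq // mulrA (exprSr (1 - _)).
  by move=> q /cs0 q0; have [] := fP q q0.
- move=> x /(csq_subsq (ltn0Sn m.*2))[ij xij] /= nx.
  have ijc : ij != center m.
    by apply/eqP => ijc; apply: nx; left; rewrite -ijc.
  have [_ _ /(_ x xij)] := fP _ (subsq_gt0 ij p0).
  case=> [xn|q qf qx]; first by apply: nx; right; exists ij.
  exists q => //; apply/flattenP; exists (f (subsq p ij)) => //.
  by apply: map_f; apply: map_f; rewrite mem_enum.
Qed.

(* Descend from [p] to a child square met by [F] as long as there is one which is
   not central; after [n] steps nothing of [F] would be left. *)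
Lemma nest_isolated m n p F : (0 < m)%N -> 0 < p.2 ->
  F `&` osq p !=set0 -> F `&` osq p `<=` nest m n p ->
  exists q, [/\ 0 < q.2, osq q `<=` osq p, F `&` osq q !=set0 &
    F `&` osq q `<=` csq (subsq q (center m))].
Proof.
move=> m0; elim: n p => [|n IH] p p0 [x [Fx px]] Fp; first by have := Fp x (conj Fx px).
have [[ij [ijc Fij]]|noij] := pselect (exists ij : 'I_m.*2.+1 * 'I_m.*2.+1,
    ij != center m /\ F `&` osq (subsq p ij) !=set0).
  have [|q [q0 qij Fq Fqc]] := IH (subsq p ij) (subsq_gt0 ij p0) Fij.
    move=> y [Fy yij]; have [yc|[kl /= klc ykl]] := Fp y (conj Fy (osq_subsq p0 yij)).
      by have ijE := osq_subsq_disjoint p0 yij yc; rewrite ijE eqxx in ijc.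
    suff -> : ij = kl by [].
    apply: (osq_subsq_disjoint p0 yij); apply: osq_csq.
    exact: nest_osq m0 (subsq_gt0 kl p0) _ ykl.
  by exists q; split=> //; apply: subset_trans qij _; exact: osq_subsq.
exists p; split=> //; first by exists x.
move=> y [Fy yp]; have [//|[kl /= klc ykl]] := Fp y (conj Fy yp).
exfalso; apply: noij; exists kl; split=> //; exists y; split=> //.
exact: nest_osq m0 (subsq_gt0 kl p0) _ ykl.
Qed.

(** Inside [q] the set stays within q.2/(2m+1) of the centre, and its other points avoid the
    inscribed disc of radius q.2/2. The empty annulus has modulus ln((2m+1)/2), unbounded in [m]. *)
Lemma isolated_separates m q F : (0 < m)%N -> 0 < q.2 ->
  F `&` osq q !=set0 -> F `&` osq q `<=` csq (subsq q (center m)) ->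
  (exists2 y, F y & ~ osq q y) ->
  separates (mid q) (q.2 / m.*2.+1%:R) (q.2 / 2) F.
Proof.
move=> m0 q0 [x [Fx xq]] Fq [y Fy yq].
have cent z : F z -> osq q z -> edist z (mid q) <= q.2 / m.*2.+1%:R.
  by move=> Fz zq; have [] := csq_center m0 q0 (Fq z (conj Fz zq)).
have osq_near z : edist z (mid q) < q.2 / 2 -> osq q z.
  move=> zq; have := le_edist1 z (mid q); have := le_edist2 z (mid q).
  rewrite !ler_norml /mid /= => /andP[? ?] /andP[? ?].
  by split; apply/andP; split; rewrite /mid in zq; lra.
apply: separates_disc_exterior.
- by rewrite divr_gt0 // ltr0n.
- rewrite ltr_pM2l // ltf_pV2 ?posrE ?ltr0n // ltr_nat.
  by rewrite ltnS -addnn (leq_add m0 m0).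
- apply/seteqP; split=> // z [Fz /andP[z1 z2]].
  by move: z1; apply/negP; rewrite -leNgt; apply: cent => //; exact: osq_near.
- by exists x => //; exact: cent.
- by exists y => //; rewrite leNgt; apply/negP => /osq_near.
Qed.

Definition unit_square : plane R * R := ((0, 0), 1).

(** The preliminary cells shrink with [M], so that two given points eventually lie in different
    ones; the gaps thicken with [M]; [n] is left free to control the area. *)
Definition nest_level M n : set (plane R) :=
  \bigcup_(ij : 'I_M.+1 * 'I_M.+1) nest M.+1 n (subsq unit_square ij).

Lemma nest_level_closed M n : closed (nest_level M n).
Proof.
by apply: closed_bigcup => [|ij _]; [exact: finite_finset|exact: nest_closed].
Qed.

Lemma subsq_unit_gt0 M (ij : 'I_M.+1 * 'I_M.+1) : 0 < (subsq unit_square ij).2.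
Proof. by apply: subsq_gt0; rewrite /= ltr01. Qed.

Lemma compact_csq p : compact (csq p).
Proof. by apply: compact_setX; exact: segment_compact. Qed.

Lemma nest_level_sub M n : nest_level M n `<=` csq unit_square.
Proof.
move=> x [ij _ /(nest_osq (ltn0Sn M) (subsq_unit_gt0 ij))].
by move=> /(osq_subsq (p := unit_square)) xQ; apply/osq_csq/xQ; rewrite /= ltr01.
Qed.

Lemma measurable_nest_level M n : measurable (nest_level M n).
Proof.
apply: compact_measurable_plane.
apply: subclosed_compact (compact_csq (p := unit_square)) _; first exact: nest_level_closed.
exact: nest_level_sub.
Qed.

Lemma nest_level_m2 M e : 0 < e -> exists n,
  (m2 (csq unit_square `\` nest_level M n) <= e%:E)%E.
Proof.
move=> e0; pose rho : R := 1 - ((M.+1).*2.+1%:R ^+ 2)^-1.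
have N1 : 1 < (M.+1).*2.+1%:R ^+ 2 :> R.
  by rewrite -natrX ltr1n -(exp1n 2) ltn_exp2r.
have N0 : 0 < (M.+1).*2.+1%:R ^+ 2 :> R by exact: lt_trans N1.
have rho0 : 0 <= rho by rewrite subr_ge0 invf_le1 // ltW.
have rho1 : rho < 1 by rewrite gtrBl invr_gt0.
have [n rn] := exists_small_expr rho0 rho1 e0; exists n.
have : forall ij : 'I_M.+1 * 'I_M.+1, exists l : seq (plane R * R), [/\ forall q, q \in l -> 0 < q.2,
     \sum_(q <- l) q.2 ^+ 2 = rho ^+ n * (subsq unit_square ij).2 ^+ 2 &
     forall x, csq (subsq unit_square ij) x ->
       ~ nest M.+1 n (subsq unit_square ij) x -> exists2 q, q \in l & csq q x].
  by move=> ij; exact: (nest_cover M.+1 n (subsq_unit_gt0 ij)).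
move=> /choice[f fP].
pose ijs := enum {: 'I_M.+1 * 'I_M.+1}.
apply: le_trans (m2_le_squares (l := flatten [seq f ij | ij <- ijs]) _ _ _) _.
- by apply: measurableD; [exact: measurable_csq|exact: measurable_nest_level].
- move=> q /flattenP[_ /mapP[ij _ ->]] qf; have [+ _ _] := fP ij.
  by move=> /(_ q qf)/ltW.
- move=> x [/(csq_subsq (ltn0Sn M))[ij xij] xn].
  have [_ _ /(_ x xij)] := fP ij; case=> [xij'|q qf qx]; first by apply: xn; exists ij.
  by exists q => //; apply/flattenP; exists (f ij) => //; apply: map_f; rewrite mem_enum.
rewrite lee_fin big_flatten big_map /=.
under eq_bigr => ij _ do have [_ -> _] := fP ij.
rewrite big_enum /= sumr_const card_prod card_ord /= div1r.
rewrite -[leLHS]mulr_natr natrM -expr2 -mulrA -exprMn mulVf ?pnatr_eq0 //.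
by rewrite expr1n mulr1 ltW.
Qed.

Lemma fat_HNUP (n : nat -> nat) : HNUP (\bigcap_M nest_level M (n M)).
Proof.
set E := \bigcap_M _.
have cE : compact E.
  apply: (subclosed_compact _ (compact_csq (p := unit_square))).
    by apply: closed_bigI => M _; exact: nest_level_closed.
  by move=> x /(_ 0%N I)/nest_level_sub.
split=> // F FE cF [_ [x [y [Fx Fy /edist_gt0 xy]]] [B FB]].
(* M + 1 exceeds both 2/|x - y|, so that no cell contains both points, and e^B, so that the modulus
   ln((2M+3)/2) exceeds [B]. *)
pose M := Num.truncn (Num.max (2 / edist x y) (expR B)).
have max0 : 0 <= Num.max (2 / edist x y) (expR B).
  by rewrite le_max expR_ge0 orbT.
have MB := truncnS_gt (Num.max (2 / edist x y) (expR B)).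
move: MB; rewrite gt_max -/M => /andP[Mxy MB].
have M0 : 0 < M.+1%:R :> R by rewrite ltr0n.
have [ij _ xij] : nest_level M (n M) x by apply: FE.
pose p : plane R * R := subsq unit_square ij.
have p0 : 0 < p.2 by exact: subsq_unit_gt0.
have xp : osq p x by apply: nest_osq xij.
(* The nests of the other cells are confined to their own open cells, so only the nest of [p]
   matters inside [p]. *)
have Fp : F `&` osq p `<=` nest M.+1 (n M) p.
  move=> z [/FE/(_ M I)[kl _ zkl] zp].
  suff -> : p = subsq unit_square kl by [].
  congr subsq; apply: (osq_subsq_disjoint _ zp); first by rewrite /= ltr01.
  apply: osq_csq; apply: nest_osq zkl => //; exact: subsq_unit_gt0.
have yp : ~ osq p y.
  move=> /osq_csq yp; have := csq_edist (osq_csq xp) yp.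
  rewrite /p /= div1r; apply/negP; rewrite -ltNge ltr_pdivrMr //.
  by rewrite mulrC -ltr_pdivrMr.
have [|q [q0 qp Fq Fqc]] := nest_isolated (ltn0Sn M) p0 _ Fp.
  by exists x.
have /FB : separates (mid q) (q.2 / (M.+1).*2.+1%:R) (q.2 / 2) F.
  by apply: isolated_separates => //; exists y => // /qp.
have N0 : 0 < (M.+1).*2.+1%:R :> R by rewrite ltr0n.
have -> : q.2 / 2 / (q.2 / (M.+1).*2.+1%:R) = (M.+1).*2.+1%:R / 2.
  by field; rewrite !gt_eqF.
have BM : B < ln ((M.+1).*2.+1%:R / 2).
  rewrite -ltr_expR lnK ?posrE ?divr_gt0 //; apply: lt_trans MB _.
  by rewrite ltr_pdivlMr // -natrM ltr_nat muln2 ltnSn.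
have NM : 2 < (M.+1).*2.+1%:R :> R by rewrite ltr_nat.
move=> /(_ _ _); rewrite leNgt BM => H; suff : false by [].
apply: H; first by rewrite divr_gt0.
by rewrite ltr_pM2l // ltf_pV2 // posrE.
Qed.

Lemma fat_m2 : exists n : nat -> nat, m2 (\bigcap_M nest_level M (n M)) <> 0%E.
Proof.
have e0 M : 0 < 2^-1 / 2 ^+ M.+1 :> R by rewrite divr_gt0 // exprn_gt0.
have /choice[n nM] := fun M => nest_level_m2 M (e0 M).
exists n; set E := \bigcap_M _ => E0.
have [cE _] := fat_HNUP n.
have mE := compact_measurable_plane cE.
have mD M : measurable (csq unit_square `\` nest_level M (n M)).
  by apply: measurableD; [exact: measurable_csq|exact: measurable_nest_level].
(* The unit square is covered by [E] and by what the levels lose. These losses total at most 1/2, so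
   [E] cannot be null. *)
pose G M := if M is M'.+1 then csq unit_square `\` nest_level M' (n M') else E.
have : (m2 (csq unit_square) <= \sum_(0 <= M <oo) m2 (G M))%E.
  apply: measure_sigma_subadditive.
  - by case.
  - exact: measurable_csq.
  - move=> x xQ; have [Ex|nEx] := pselect (E x); first by exists 0%N.
    move: nEx => /existsNP[M /not_implyP[_ nx]].
    by exists M.+1.
rewrite m2_csq ?ler01 //= expr1n; apply/negP; rewrite -ltNge.
apply: (@le_lt_trans _ _ (2^-1)%:E); last by rewrite lte_fin invf_lt1 // ltr1n.
apply: lime_le; first by apply: is_cvg_nneseries => M _ _; exact: measure_ge0.
apply: nearW => -[|k]; first by rewrite big_geq // lee_fin.
rewrite big_nat_recl //= E0 add0e.
apply: (@le_trans _ _ (\sum_(0 <= M < k) (2^-1 / 2 ^+ M.+1 : R)%:E)%E).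
  by apply: lee_sum => M _; exact: nM.
by rewrite sumEFin lee_fin sum_half_powers.
Qed.

End FatHNUP.

(** * A segment and a Cantor set *)

Section Segment.
Variable R : realType.

Definition segment : set (plane R) := affine (0, 0) (1, 0) @` `[0, 1].

Lemma compact_segment : compact segment.
Proof.
apply: continuous_compact; last exact: segment_compact.
exact/continuous_subspaceT/affine_continuous.
Qed.

Lemma segmentP x : segment x <-> 0 <= x.1 <= 1 /\ x.2 = 0.
Proof.
split=> [[t /= + <-]|[x1 x2]].
  by rewrite in_itv /affine /= !subr0 !mulr0 mulr1 !addr0 add0r.
exists x.1; first by rewrite /= in_itv.
by rewrite /affine /= !subr0 mulr0 mulr1 addr0 add0r -x2 -surjective_pairing.
Qed.

Lemma segment_uniformly_perfect : uniformly_perfect segment.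
Proof.
split; first exact: compact_segment.
  exists (0, 0), (1, 0); split; try by apply/segmentP; rewrite /= ?lexx ?ler01.
  by move=> /(congr1 fst)/eqP; rewrite eq_sym oner_eq0.
exists 0 => w r s r0 rs ws; exfalso.
by apply: (connected_not_separates r0 rs _ ws); exact: connected_affine.
Qed.

(** The open disc of radius r/2 centred r/2 above [a] is tangent to the line and misses it. *)
Lemma segment_porous : porous segment.
Proof.
split; first exact: compact_segment.
exists 2^-1 => // a r /segmentP[_ a2] r0.
pose b : plane R := (a.1, r / 2).
have ab : edist b a <= r / 2.
  rewrite edist_le_sqr /=; last by rewrite divr_ge0 // ltW.
  by rewrite subrr a2 subr0 expr0n add0r.
exists b.
  move=> x; rewrite /disc /= => xb.
  by apply: le_lt_trans (edist_triangle b _ _) _; lra.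
apply/seteqP; split=> // x [+ /segmentP[_ x2]]; rewrite /disc /= => xb.
have := le_lt_trans (le_edist2 x b) xb; rewrite /b /= x2 sub0r normrN.
by rewrite gtr0_norm ?divr_gt0 // mulrC ltxx.
Qed.

Lemma segment_not_HNUP : ~ HNUP segment.
Proof.
by move=> [_ /(_ segment)]; apply => //;
   [exact: compact_segment|exact: segment_uniformly_perfect].
Qed.

End Segment.

(** * A Cantor set of dimension zero and positive capacity *)

Section CantorSet.
Variable R : realType.
Implicit Types (x y z q : plane R) (u v w s t e : R).

(** The spacing of the left ends of the four children of an interval of step [j], whose length is
    four times this. The lengths decrease by squaring, up to the factor 4. *)
Definition csize j : R := 16^-1 ^+ (2 ^ j).

Fixpoint cpoints k : seq R :=
  if k is k'.+1 then [seq v + d%:R * csize k' | v <- cpoints k', d <- iota 0 4]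
  else [:: 0].

Definition cantor4 : set (plane R) := \bigcap_k \bigcup_(v in [set` cpoints k])
  (`[v, v + 4 * csize k] `*` [set 0]).

Lemma csize_gt0 j : 0 < csize j.
Proof. by rewrite exprn_gt0. Qed.

Lemma csizeS j : 16 * csize j.+1 <= csize j.
Proof.
rewrite /csize expnS mul2n -addnn exprD mulrA ger_pMl ?exprn_gt0 //.
have : 16^-1 ^+ (2 ^ j) <= 16^-1 ^+ 1 :> R.
  by rewrite ler_wiXn2l // ?invr_ge0 // ?invf_le1 ?ler1n // expn_gt0.
by rewrite expr1; lra.
Qed.

Lemma cpoints_parent k v : v \in cpoints k.+1 ->
  exists2 u, u \in cpoints k & u <= v /\ v + 4 * csize k.+1 <= u + 4 * csize k.
Proof.
move=> /allpairsP[[u d] [/= uk dI ->]].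
have d4 : (d < 4)%N by move: dI; rewrite !inE => /or4P[] /eqP->.
exists u => //; have c0 := csize_gt0 k; have cS := csizeS k.
split; first by rewrite lerDl mulr_ge0 // ltW.
have : d%:R * csize k <= 3 * csize k by rewrite ler_pM2r // (ler_nat _ _ 3).
by lra.
Qed.

Lemma cpoints_child k v d : v \in cpoints k -> (d < 4)%N ->
  v + d%:R * csize k \in cpoints k.+1.
Proof.
move=> vk d4; apply/allpairsP; exists (v, d) => /=; split=> //.
by case: d d4 => [|[|[|[|d]]]].
Qed.

Lemma cpoints_sub j k v : v \in cpoints j -> exists2 u, u \in cpoints k &
  u <= v <= u + 4 * csize k.
Proof.
move=> vj; have [jk|kj] := leqP j k.
  exists v; last by rewrite lexx lerDl mulr_ge0 // ltW // csize_gt0.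
  rewrite -(subnK jk); elim: (k - j)%N => // n IH; rewrite addSn.
  by have := cpoints_child (d := 0) IH isT; rewrite mul0r addr0.
suff [u uk [uv vu]] : exists2 u, u \in cpoints k &
    u <= v /\ v + 4 * csize j <= u + 4 * csize k.
  exists u => //; rewrite uv /=; apply: le_trans vu.
  by rewrite lerDl mulr_ge0 // ltW // csize_gt0.
rewrite -(subnK (ltnW kj)) in vj *.
elim: (j - k)%N v vj => [|n IH] v vj; first by exists v.
have [u uj [uv vu]] := cpoints_parent vj.
have [u' uk [uv' vu']] := IH u uj.
by exists u' => //; split; [exact: le_trans uv|exact: le_trans vu'].
Qed.

Lemma cpoints_cantor4 j v : v \in cpoints j -> cantor4 (v, 0).
Proof.
move=> vj k _; have [u uk uv] := cpoints_sub k vj.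
by exists u => //; split; rewrite //= in_itv.
Qed.

Lemma compact_cantor4 : compact cantor4.
Proof.
have cI v (a : R) : compact (`[v, v + a] `*` [set 0] : set (plane R)).
  by apply: compact_setX; [exact: segment_compact|exact: compact_set1].
apply: subclosed_compact (cI 0 (4 * csize 0)) _; last first.
  by move=> x /(_ 0%N I)[v /=]; rewrite inE => /eqP->.
apply: closed_bigI => k _; apply: closed_bigcup; first exact: finite_seq.
by move=> v _; apply: compact_closed; [exact: plane_hausdorff|exact: cI].
Qed.

Lemma size_cpoints k : size (cpoints k) = (4 ^ k)%N.
Proof. by elim: k => // k IH; rewrite [cpoints _]/(allpairs _ _ _) size_allpairs IH expnSr. Qed.

Lemma csize_sum_small s e : 0 < s -> 0 < e ->
  exists k, 4 ^+ k * (8 * csize k) `^ s <= e.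
Proof.
move=> s0 e0; pose l : R := s * ln 16.
have ln16 : 0 < ln 16 :> R by rewrite ln_gt0 // ltr1n.
have l0 : 0 < l by rewrite mulr_gt0.
(* With n = 2^k the quantity is n^2 8^s e^(-n l). The bound e^(n l) >= (n l/3)^3 beats n^2 and
   leaves C/n. *)
pose C : R := 8 `^ s * (3 / l) ^+ 3.
have C0 : 0 < C by rewrite mulr_gt0 ?powR_gt0 // exprn_gt0 // divr_gt0.
pose k := Num.truncn (C / e); exists k.
have kC : C / e <= 2 ^+ k.
  apply: ltW; apply: lt_le_trans (truncnS_gt _) _.
  by rewrite -natrX ler_nat -/k ltn_expl.
pose n : R := 2 ^+ k; have n0 : 0 < n by rewrite exprn_gt0.
have nE : (2 ^ k)%:R = n by rewrite natrX.
have -> : 4 ^+ k = n ^+ 2.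
  by rewrite (_ : 4 = 2 ^+ 2) ?/n -?exprM 1?mulnC // -natrX.
rewrite powRM //; last exact/ltW/csize_gt0.
have -> : csize k `^ s = expR (n * (l / 3)) ^- 3.
  have -> : csize k = expR (- (n * ln 16)).
    by rewrite /csize exprVn expRN -nE expRM_natl lnK // posrE.
  rewrite -expRM_natl -expRN /powR gt_eqF ?expR_gt0 // expRK.
  by congr expR; rewrite /l; field.
have en : n * (l / 3) <= expR (n * (l / 3)).
  by apply: le_trans (expR_ge1Dx _); rewrite lerDr.
have nl : 0 < n * (l / 3) by rewrite mulr_gt0 // divr_gt0.
apply: (@le_trans _ _ (n ^+ 2 * (8 `^ s * (n * (l / 3)) ^- 3))).
  rewrite ler_pM2l ?exprn_gt0 // ler_pM2l ?powR_gt0 //.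
  rewrite lef_pV2 ?posrE ?exprn_gt0 ?expR_gt0 //.
  by rewrite lerXn2r // nnegrE ltW // expR_gt0.
have -> : n ^+ 2 * (8 `^ s * (n * (l / 3)) ^- 3) = C / n.
  by rewrite /C; field; rewrite !gt_eqF.
by rewrite ler_pdivrMr // mulrC -ler_pdivrMr.
Qed.

Lemma dimH_cantor4 : dimH cantor4 = 0%E.
Proof.
apply: dimH_eq0_of_covers => s e s0 e0.
have [k ke] := csize_sum_small s0 e0.
have c0 := csize_gt0 k.
exists [seq ((v, 0), 8 * csize k) | v <- cpoints k]; last first.
  rewrite /dim_sum big_map /= big_tnth sumr_const card_ord size_cpoints.
  by rewrite -[leLHS]mulr_natl natrX.
split=> [_ /mapP[v _ ->] /=|x /(_ k I)[v /= vk [/=]]]; first by rewrite mulr_gt0.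
rewrite in_itv /= => /andP[vx xv] x2.
exists ((v, 0), 8 * csize k); first exact: map_f.
rewrite /disc /=; apply: le_lt_trans (edist_le_add _ _) _.
rewrite /= x2 subrr normr0 addr0 ger0_norm ?subr_ge0 //; lra.
Qed.

(** A lower bound for the distance to points not near the chosen child. It is taken as 64^(-2^j),
    smaller than csize_j/4 in general, so that passing to the next step squares it exactly. *)
Definition cgap j : R := (4^-1 * 16^-1) ^+ (2 ^ j).

Lemma cgap_le j : cgap j <= csize j / 4.
Proof.
rewrite /cgap exprMn mulrC ler_pM2l ?csize_gt0 // -[leRHS]expr1.
by rewrite ler_wiXn2l // ?invr_ge0 // ?invf_le1 ?ler1n // expn_gt0.
Qed.

Lemma cgap01 j : 0 < cgap j <= 1.
Proof. by rewrite /cgap exprn_gt0 ?exprn_ile1 //=; lra. Qed.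

Lemma few_of_four (T : Type) (Z : seq T) (a : nat -> pred T) :
  (forall c i j, (i < 4)%N -> (j < 4)%N -> a i c -> a j c -> i = j) ->
  exists2 d, (d < 4)%N & (4 * count (a d) Z <= size Z)%N.
Proof.
move=> adisj; apply: contrapT => nod.
have many d : (d < 4)%N -> (size Z < 4 * count (a d) Z)%N.
  by move=> d4; rewrite ltnNge; apply/negP => dZ; apply: nod; exists d.
have : (count (a 0) Z + count (a 1) Z + count (a 2) Z + count (a 3) Z <= size Z)%N.
  elim: Z {nod many} => //= c Z IH.
  have aq i j : (i < 4)%N -> (j < 4)%N -> i != j -> (a i c + a j c <= 1)%N.
    move=> i4 j4; case: (boolP (a i c)) => // ai; case: (boolP (a j c)) => // aj.
    by rewrite (adisj c i j i4 j4 ai aj) eqxx.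
  have := aq 0%N 1%N isT isT isT; have := aq 0%N 2%N isT isT isT; have := aq 0%N 3%N isT isT isT.
  have := aq 1%N 2%N isT isT isT; have := aq 1%N 3%N isT isT isT; have := aq 2%N 3%N isT isT isT.
  move: (a 0%N c) (a 1%N c) (a 2%N c) (a 3%N c) IH => [] [] [] [] //=; lia.
have := many 0%N isT; have := many 1%N isT; have := many 2%N isT; have := many 3%N isT.
lia.
Qed.

(* Descend into the child interval which is close to the fewest of the points;
   at most a quarter of them survive each step. *)
Lemma cantor4_far_point (Z : seq (plane R)) j v : v \in cpoints j ->
  exists k w, [/\ w \in cpoints k, v <= w <= v + 4 * csize j &
    cgap j ^+ (2 * size Z) <= \prod_(q <- Z) edist q (w, 0)].
Proof.
have [n] := ubnP (size Z); elim: n Z j v => // n IH Z j v Zn vj.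
have c0 := csize_gt0 j.
have [->|/negP Z0] := eqVneq Z [::].
  exists j, v; rewrite big_nil muln0 expr0; split=> //.
  by rewrite lexx lerDl mulr_ge0 // ltW.
(* Left ends are [csize j] apart, so no point is near two of them. A point not near child d is at
   distance at least csize_j/2 - 4 csize_(j+1) >= csize_j/4 from that child. *)
pose a (d : nat) (q : plane R) := `|q.1 - (v + d%:R * csize j)| < csize j / 2.
have [|d d4 dZ] := @few_of_four _ Z a.
  move=> q i k _ _; rewrite /a !ltr_norml => /andP[i1 i2] /andP[k1 k2].
  have ik : i%:R * csize j < k.+1%:R * csize j by rewrite -natr1; lra.
  have ki : k%:R * csize j < i.+1%:R * csize j by rewrite -natr1; lra.
  rewrite ltr_pM2r // ltr_nat ltnS in ik; rewrite ltr_pM2r // ltr_nat ltnS in ki.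
  by apply/eqP; rewrite eqn_leq ik ki.
pose Z' := [seq q <- Z | a d q].
have szZ' : size Z' = count (a d) Z by rewrite size_filter.
have szZ : (0 < size Z)%N by case: (Z) Z0.
have vd := cpoints_child vj d4.
have [|k [w [wk /andP[vw wv] wZ]]] := IH Z' j.+1 _ _ vd; first by rewrite szZ'; lia.
have cS := csizeS j; have c1 := csize_gt0 j.+1.
have d3 : d%:R * csize j <= 3 * csize j by rewrite ler_pM2r // (ler_nat _ _ 3).
have d0 : 0 <= d%:R * csize j by rewrite mulr_ge0 // ltW.
exists k, w; split=> //; first by apply/andP; split; lra.
have /andP[g0 g1] := cgap01 j.
have far q : ~~ a d q -> cgap j <= edist q (w, 0).
  rewrite /a -leNgt => qd; apply: le_trans (le_edist1 _ _); rewrite /=.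
  apply: le_trans (cgap_le j) _.
  have := ler_distD w q.1 (v + d%:R * csize j).
  rewrite (ger0_norm (_ : 0 <= w - _)) ?subr_ge0 //; lra.
rewrite (bigID (a d)) /= -big_filter -/Z'.
(* The near points cost cgap_(j+1)^(2|Z'|) = cgap_j^(4|Z'|), at least cgap_j^|Z| since 4|Z'| <= |Z|;
   the far ones cost at most another factor cgap_j^|Z|. This is why the exponent is twice the number
   of points. *)
apply: (@le_trans _ _ (cgap j.+1 ^+ (2 * size Z') * cgap j ^+ size Z)).
  have -> : cgap j.+1 = cgap j ^+ 2 by rewrite /cgap expnS mulnC exprM.
  rewrite -exprM -exprD; apply: ler_wiXn2l; rewrite ?(ltW g0) //.
  by rewrite szZ' mulnA (mul2n (size Z)) -addnn leq_add2r.
apply: ler_pM => //; [by rewrite exprn_ge0 // ltW; case/andP: (cgap01 j.+1)|exact/exprn_ge0/ltW|].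
rewrite -big_filter; set Y := [seq _ <- _ | _].
apply: (@le_trans _ _ (cgap j ^+ size Y)).
  by apply: ler_wiXn2l; rewrite ?(ltW g0) // size_filter count_size.
have : all (fun q => ~~ a d q) Y by exact: filter_all.
elim: Y => [|q Y IHY] /=; first by rewrite big_nil.
move=> /andP[/far aq /IHY YP]; rewrite big_cons exprS.
by apply: ler_pM; rewrite ?exprn_ge0 // ltW.
Qed.

(** No monic polynomial of degree n is below cgap_0^(2n) on the whole set, whereas capacity zero
    would give one bounded by (cgap_0^2/2)^n. *)
Lemma Cap_cantor4 : Cap cantor4 <> 0.
Proof.
move=> C0; have /andP[g0 g1] := cgap01 0.
have h0 : 0 < cgap 0 ^+ 2 / 2 by rewrite divr_gt0 // exprn_gt0.
have [Z Z0 ZE] := Cap_eq0_lemniscate compact_cantor4 C0 h0.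
have [k [w [wk _ wZ]]] := @cantor4_far_point Z 0 0 (mem_head _ _).
have := le_trans wZ (ZE _ (cpoints_cantor4 wk)).
apply/negP; rewrite -ltNge exprM ltrXn2r -?lt0n //; first exact: ltW.
by rewrite ltr_pdivrMr // ltr_pMr ?ltr1n ?exprn_gt0.
Qed.

End CantorSet.

(** * A non-porous set of capacity zero *)

Section CapacityOfSmallSets.
Variable R : realType.
Implicit Types (E : set (plane R)) (x y z : plane R) (d e : R).

Lemma pair_prod_sqr n (z : 'I_n -> plane R) :
  pair_prod z ^+ 2 = \prod_(i < n) \prod_(j < n | j != i) edist (z i) (z j).
Proof.
rewrite (pair_big_dep xpredT (fun i j : 'I_n => j != i)
  (fun i j : 'I_n => edist (z i) (z j))) /=.
rewrite (bigID (fun p : 'I_n * 'I_n => (p.1 < p.2)%N)) /= expr2; congr (_ * _).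
  by apply: eq_bigl => -[i j] /=; case: ltngtP => //= ij; rewrite ?andbF // andbT -val_eqE /= gtn_eqF.
rewrite /pair_prod (reindex_inj (h := fun p => (p.2, p.1))) /=; last first.
  by move=> [i j] [k l] [-> ->].
apply: eq_big => [[i j]|[i j] _] /=; last exact: edistC.
by rewrite -leqNgt -val_eqE /= ltn_neqAle.
Qed.

(* Among [n = 2 |G| + 2] distinct points of [E] at least half lie outside [G],
   so a quarter of the distances is at most [d]. *)
Lemma Cap_le_finite_small E (G : seq (plane R)) d : compact E -> 0 < d -> d <= 1 ->
  (forall x y, E x -> E y -> edist x y <= 1) ->
  (forall x y, E x -> E y -> x \notin G -> y \notin G -> edist x y <= d) ->
  Cap E <= d `^ 4^-1.
Proof.
move=> cE d0 d1 E1 EG; pose N := size G; pose n := N.*2.+2.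
apply: le_trans (Cap_le_n_diam (n := n) cE isT) _.
have [n0 n1] : 0 < n%:R :> R /\ 0 < n%:R - 1 :> R.
  by rewrite ltr0n subr_gt0 ltr1n.
(* The exponent is a quarter of the number n(n-1)/2 of pairs. *)
suff PN : max_prod E n <= d `^ (n%:R * (n%:R - 1) / 8).
  rewrite /n_diam; apply: (@le_trans _ _ ((d `^ (n%:R * (n%:R - 1) / 8)) `^
      (2 / (n%:R * (n%:R - 1))))).
    by apply: ge0_ler_powR; rewrite ?nnegrE ?powR_ge0 ?max_prod_ge0 // divr_ge0 // mulr_ge0 // ltW.
  rewrite -powRrM le_eqVlt; apply/orP; left; apply/eqP; congr (_ `^ _).
  by field; rewrite !gt_eqF.
apply: max_prod_le => [|z Ez]; first exact: powR_ge0.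
(* A repeated point makes the product vanish. For distinct points, at most |G| indices can land in
   [G]. *)
have [zi|] := boolP (injectiveb z); last first.
  move=> /injectivePn[i [j ij zij]].
  suff -> : pair_prod z = 0 by exact: powR_ge0.
  apply/eqP; rewrite -sqrf_eq0 pair_prod_sqr (bigD1 i) //= (bigD1 j) 1?eq_sym //=.
  by rewrite zij edistxx !mul0r.
have {}zi := injectiveP _ zi.
pose A := [pred i | z i \notin G].
have sA : (N.+2 <= #|A|)%N.
  have cA : (#|[predC A]| <= N)%N.
    rewrite cardE -(size_map z); apply: uniq_leq_size.
      by rewrite map_inj_uniq // enum_uniq.
    by move=> _ /mapP[i + ->]; rewrite mem_enum !inE negbK.
  have nA : (#|A| + #|[predC A]| = N + N.+2)%N.
    by rewrite cardC card_ord /n -addnn !addnS.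
  by rewrite -(leq_add2l N) -nA addnC leq_add2r.
have row i : \prod_(j < n | j != i) edist (z i) (z j) <=
    if i \in A then d ^+ #|A|.-1 else 1.
  have [Ai|nAi] := boolP (i \in A); last first.
    apply: (@le_trans _ _ (\prod_(j < n | j != i) 1)); last by rewrite big1.
    apply: ler_prod => j _.
    by rewrite edist_ge0 E1.
  have -> : d ^+ #|A|.-1 = \prod_(j < n | j != i) (if j \in A then d else 1).
    rewrite -big_mkcondr /= prodr_const; congr (_ ^+ _).
    rewrite (cardD1 i A) Ai add1n /=; apply: eq_card => j.
    by rewrite !inE.
  apply: ler_prod => j _; rewrite edist_ge0 /=; case: ifP => jA; last exact: E1.
  by apply: EG.
have zd : pair_prod z ^+ 2 <= d ^+ (N.+1 * N.+2).
  rewrite pair_prod_sqr; apply: (@le_trans _ _ (\prod_i if i \in A then d ^+ #|A|.-1 else 1)).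
    by apply: ler_prod => i _; rewrite row andbT; apply: prodr_ge0 => j _; exact: edist_ge0.
  rewrite -big_mkcond /= prodr_const -exprM; apply: ler_wiXn2l; rewrite ?(ltW d0) //.
  by apply: leq_mul => //; rewrite -ltnS (leq_trans sA) // leqSpred.
rewrite -(ler_pXn2r (n := 2)) ?nnegrE ?pair_prod_ge0 ?powR_ge0 //.
apply: le_trans zd _; rewrite -!powR_mulrn ?powR_ge0 ?(ltW d0) // -powRrM.
apply: ger_powR; first by rewrite d0.
have nE : n%:R = 2 * N%:R + 2 :> R by rewrite /n -addn2 natrD -muln2 natrM mulrC.
have N0 : 0 <= N%:R :> R by [].
have -> : (N.+1 * N.+2)%:R = (N%:R + 1) * (N%:R + 2) :> R.
  by rewrite natrM -[N.+2]addn2 natrD natr1.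
by rewrite nE; move: (N%:R) N0 => t t0; nra.
Qed.

End CapacityOfSmallSets.

(** * Grids accumulating at the origin *)

Section GridSequence.
Variable R : realType.
Implicit Types (x y z : plane R) (i j k K : nat).

(* The scaling by 1/4 makes the diameter of the whole set at most 1. *)
Definition grid_coord k i : R := (i%:R - k.+1%:R) * (4 * k.+1%:R ^+ 2)^-1.

Definition grid k : seq (plane R) :=
  [seq (grid_coord k i, grid_coord k j) | i <- iota 0 k.+1.*2.+1, j <- iota 0 k.+1.*2.+1].

Definition small_square K : set (plane R) :=
  `[- (4 * K.+1%:R)^-1, (4 * K.+1%:R)^-1] `*` `[- (4 * K.+1%:R)^-1, (4 * K.+1%:R)^-1].

Definition grids_upto K : seq (plane R) := flatten [seq grid k | k <- iota 0 K].

(* Contains [0] and all the grids, which accumulate only at [0]. *)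
Definition grid_set : set (plane R) :=
  \bigcap_K (small_square K `|` [set` grids_upto K]).

Lemma small_square_compact K : compact (small_square K).
Proof. by apply: compact_setX; exact: segment_compact. Qed.

Lemma small_squareP K x : small_square K x <->
  `|x.1| <= (4 * K.+1%:R)^-1 /\ `|x.2| <= (4 * K.+1%:R)^-1.
Proof. by rewrite /small_square /= !in_itv /= !ler_norml. Qed.

Lemma compact_grid_set : compact grid_set.
Proof.
apply: subclosed_compact (small_square_compact (K := 0)) _; last first.
  by move=> x /(_ 0%N I)[].
apply: closed_bigI => K _; apply: closedU; apply: compact_closed;
  try exact: plane_hausdorff.
  exact: small_square_compact.
by apply: finite_compact; exact: finite_seq.
Qed.

Lemma grid_step (n : R) : 0 < n -> (4 * n)^-1 = n * (4 * n ^+ 2)^-1.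
Proof. by move=> n0; field; rewrite gt_eqF. Qed.

Lemma grid_coord_le k i : (i < k.+1.*2.+1)%N -> `|grid_coord k i| <= (4 * k.+1%:R)^-1.
Proof.
move=> ik; have k0 : 0 < k.+1%:R :> R by rewrite ltr0n.
rewrite grid_step //.
rewrite normrM (ger0_norm (x := _^-1)) ?invr_ge0 ?mulr_ge0 ?exprn_ge0 ?(ltW k0) //.
rewrite ler_pM2r ?invr_gt0 ?mulr_gt0 ?exprn_gt0 // ler_norml.
rewrite ltnS -addnn -(ler_nat R) natrD in ik.
by have : 0 <= i%:R :> R by []; move=> ?; apply/andP; split; lra.
Qed.

Lemma grid_sub k x : x \in grid k -> grid_set x.
Proof.
move=> xk K _; have [Kk|kK] := leqP K k; last first.
  right; apply/flattenP; exists (grid k) => //; apply: map_f.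
  by rewrite mem_iota.
left; apply/small_squareP.
have kK : (4 * k.+1%:R)^-1 <= (4 * K.+1%:R)^-1 :> R.
  by rewrite lef_pV2 ?posrE ?mulr_gt0 ?ltr0n // ler_pM2l // ler_nat.
move: xk => /allpairsP[[i j] []]; rewrite !mem_iota => /andP[_ ik] /andP[_ jk] ->.
by split; apply: le_trans kK; apply: grid_coord_le.
Qed.

Lemma small_square_edist K x y : small_square K x -> small_square K y ->
  edist x y <= K.+1%:R^-1.
Proof.
move=> /small_squareP[x1 x2] /small_squareP[y1 y2].
apply: le_trans (edist_le_add _ _) _.
have := ler_normB x.1 y.1; have := ler_normB x.2 y.2.
have -> : K.+1%:R^-1 = 4 * (4 * K.+1%:R)^-1 :> R by rewrite invfM mulVKf ?pnatr_eq0.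
by move: (_^-1) x1 x2 y1 y2 => h; lra.
Qed.

(** Outside finitely many points the set lies in a square of Euclidean diameter at most 1/(K+1), so
    its capacity is at most (1/(K+1))^(1/4) for every K. *)
Lemma Cap_grid_set : Cap grid_set = 0.
Proof.
apply/eqP; rewrite eq_le Cap_ge0 ?andbT; last exact: compact_grid_set.
apply/ler_addgt0Pr => e e0; rewrite add0r.
pose K := Num.truncn (e `^ 4)^-1.
have e4 : 0 < e `^ 4 by rewrite powR_gt0.
have Ke : K.+1%:R^-1 < e `^ 4.
  by rewrite invf_plt ?posrE ?ltr0n // truncnS_gt // invr_ge0 ltW.
apply: (@le_trans _ _ (K.+1%:R^-1 `^ 4^-1)).
  apply: (@Cap_le_finite_small _ _ (grids_upto K)).
  - exact: compact_grid_set.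
  - by rewrite invr_gt0 ltr0n.
  - by rewrite invf_le1 ?ler1n ?ltr0n.
  - move=> x y /(_ 0%N I)[x0|//] /(_ 0%N I)[y0|//].
    by apply: le_trans (small_square_edist x0 y0) _; rewrite invr1.
  - move=> x y /(_ K I)[xK|/= ->//] /(_ K I)[yK|/= ->//] _ _.
    exact: small_square_edist.
have -> : e = (e `^ 4) `^ 4^-1 by rewrite -powRrM divff // powRr1 // ltW.
by apply: ge0_ler_powR; rewrite ?nnegrE ?invr_ge0 ?(ltW e4) // ltW.
Qed.

Lemma grid_coord_near k (t : R) : `|t| <= (4 * k.+1%:R)^-1 ->
  exists2 i, (i < k.+1.*2.+1)%N & `|grid_coord k i - t| <= (4 * k.+1%:R ^+ 2)^-1.
Proof.
rewrite grid_step ?ltr0n // /grid_coord; move: (_^-1) => h; rewrite ler_norml => /andP[t1 t2].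
have [||i /andP[i1 i2]] := @subinterval R k.*2.+1 h (t + k.+1%:R * h).
- lra.
- by rewrite -doubleS -addnn natrD; lra.
exists i; first by rewrite doubleS ltnW // ltnS.
by rewrite ler_norml mulrBl; apply/andP; split; lra.
Qed.

(** At the origin take for r the half-width of grid k. Every point within r of the origin has a grid
    point within 2r/(k+1), which is less than c r once k + 1 > 2/c, so no disc of radius c r in it
    is empty. *)
Lemma grid_set_not_porous : ~ porous grid_set.
Proof.
move=> [_ [c c0 /(_ (0, 0))]].
pose k := Num.truncn (2 / c).
have kc : 2 < k.+1%:R * c by rewrite -ltr_pdivrMr // truncnS_gt // divr_ge0 // ltW.
have k0 : 0 < k.+1%:R :> R by rewrite ltr0n.
have Z0 : grid_set (0, 0).
  move=> K _; left; apply/small_squareP.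
  by rewrite /= normr0 invr_ge0 mulr_ge0.
pose r : R := (4 * k.+1%:R)^-1.
have r0 : 0 < r by rewrite invr_gt0 mulr_gt0.
move=> /(_ r Z0 r0)[b bsub bE].
have : disc (0, 0) r b by apply: bsub; rewrite /disc /= edistxx mulr_gt0.
rewrite /disc /= => br.
have b1 := le_trans (le_edist1 b (0, 0)) (ltW br).
have b2 := le_trans (le_edist2 b (0, 0)) (ltW br).
rewrite /= !subr0 in b1 b2.
have [i ik ib] := grid_coord_near b1; have [j jk jb] := grid_coord_near b2.
pose p : plane R := (grid_coord k i, grid_coord k j).
have pE : grid_set p.
  apply: (@grid_sub k); apply/allpairsP; exists (i, j).
  by rewrite !mem_iota.
suff : (disc b (c * r) `&` grid_set) p by rewrite bE.
split=> //; rewrite /disc /=; apply: le_lt_trans (edist_le_add _ _) _.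
apply: le_lt_trans (lerD ib jb) _.
have -> : (4 * k.+1%:R ^+ 2)^-1 = k.+1%:R^-1 * r.
  by rewrite /r (grid_step k0) mulKf // gt_eqF.
have kc' : 2 / k.+1%:R < c by rewrite ltr_pdivrMr // mulrC.
by rewrite -mulrDl ltr_pM2r // -mulr2n -[ltLHS]mulr_natl.
Qed.

End GridSequence.

Theorem theorem1p1 (R : realType) :
  (* the six non-trivial implications that hold, and the trivial ones *)
  (forall E : set (plane R), compact E ->
     (Cap E = 0 -> dimH E = 0%E) /\
     (dimH E = 0%E -> HNUP E) /\
     (Cap E = 0 -> HNUP E) /\
     (dimH E = 0%E -> m2 E = 0%E) /\
     (Cap E = 0 -> m2 E = 0%E) /\
     (porous E -> m2 E = 0%E) /\
     (dimH E = 0%E -> dimH E = 0%E) /\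
     (Cap E = 0 -> Cap E = 0) /\
     (HNUP E -> HNUP E) /\
     (m2 E = 0%E -> m2 E = 0%E) /\
     (porous E -> porous E)) /\
  (* the fourteen implications that fail *)
  (exists E : set (plane R), compact E /\ HNUP E /\ dimH E <> 0%E) /\
  (exists E : set (plane R), compact E /\ m2 E = 0%E /\ dimH E <> 0%E) /\
  (exists E : set (plane R), compact E /\ porous E /\ dimH E <> 0%E) /\
  (exists E : set (plane R), compact E /\ dimH E = 0%E /\ Cap E <> 0) /\
  (exists E : set (plane R), compact E /\ HNUP E /\ Cap E <> 0) /\
  (exists E : set (plane R), compact E /\ m2 E = 0%E /\ Cap E <> 0) /\
  (exists E : set (plane R), compact E /\ porous E /\ Cap E <> 0) /\
  (exists E : set (plane R), compact E /\ m2 E = 0%E /\ ~ HNUP E) /\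
  (exists E : set (plane R), compact E /\ porous E /\ ~ HNUP E) /\
  (exists E : set (plane R), compact E /\ HNUP E /\ m2 E <> 0%E) /\
  (exists E : set (plane R), compact E /\ dimH E = 0%E /\ ~ porous E) /\
  (exists E : set (plane R), compact E /\ Cap E = 0 /\ ~ porous E) /\
  (exists E : set (plane R), compact E /\ HNUP E /\ ~ porous E) /\
  (exists E : set (plane R), compact E /\ m2 E = 0%E /\ ~ porous E).
Proof.
have Cap_HNUP (E : set (plane R)) : compact E -> Cap E = 0 -> HNUP E.
  by move=> cE C0; exact/dimH_eq0_HNUP/Cap_eq0_dimH.
have Cap_m2 (E : set (plane R)) : compact E -> Cap E = 0 -> m2 E = 0%E.
  by move=> cE C0; exact/dimH_eq0_m2/Cap_eq0_dimH.
have cS := @compact_segment R; have pS := segment_porous R.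
have mS := porous_m2 pS; have hS := @segment_not_HNUP R.
have dS : dimH (@segment R) <> 0%E by move=> /(dimH_eq0_HNUP cS).
have capS : Cap (@segment R) <> 0 by move=> /(Cap_HNUP _ cS).
have cC := @compact_cantor4 R; have dC := dimH_cantor4 R.
have capC := @Cap_cantor4 R; have hC := dimH_eq0_HNUP cC dC.
(* Positive measure alone rules out both dimension zero and porosity for this set. *)
have [n mF] := fat_m2 R; have hF := @fat_HNUP R n.
move: (\bigcap_M _) mF hF => F mF hF; have [cF _] := hF.
have dF : dimH F <> 0%E by move=> /(dimH_eq0_m2 cF).
have pF : ~ porous F by move=> /porous_m2.
have cG := @compact_grid_set R; have capG := Cap_grid_set R.
have pG := @grid_set_not_porous R; have dG := Cap_eq0_dimH cG capG.
have mG := Cap_m2 _ cG capG.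
split=> [E cE|].
  split; first exact: Cap_eq0_dimH.
  split; first exact: dimH_eq0_HNUP.
  split; first exact: Cap_HNUP.
  split; first exact: dimH_eq0_m2.
  split; first exact: Cap_m2.
  split; first exact: porous_m2.
  exact: (conj id (conj id (conj id (conj id id)))).
split; first by exists F; exact: (conj cF (conj hF dF)).
split; first by exists (@segment R); exact: (conj cS (conj mS dS)).
split; first by exists (@segment R); exact: (conj cS (conj pS dS)).
split; first by exists (@cantor4 R); exact: (conj cC (conj dC capC)).
split; first by exists (@cantor4 R); exact: (conj cC (conj hC capC)).
split; first by exists (@segment R); exact: (conj cS (conj mS capS)).
split; first by exists (@segment R); exact: (conj cS (conj pS capS)).
split; first by exists (@segment R); exact: (conj cS (conj mS hS)).
split; first by exists (@segment R); exact: (conj cS (conj pS hS)).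
split; first by exists F; exact: (conj cF (conj hF mF)).
split; first by exists (@grid_set R); exact: (conj cG (conj dG pG)).
split; first by exists (@grid_set R); exact: (conj cG (conj capG pG)).
split; first by exists F; exact: (conj cF (conj hF pF)).
by exists (@grid_set R); exact: (conj cG (conj mG pG)).
Qed.
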